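(* Let $\mathbb{K}$ be a field, $R=\mathbb{K}[x_1,\dots,x_d]$, and let $I$ be a (nonzero proper) squarefree monomial ideal of $R$. Then there exists a positive integer $g$ such that the symbolic analytic spread of $I$ satisfies $\ell_s(I)=\ell(I^{(g)})$. Moreover, $\ell_s(I)$ can be computed from the symbolic polyhedron: $\ell_s(I)$ equals one plus the maximal dimension of a compact face of $\mathrm{SP}(I)$.
   Context: Let $\mathfrak{m}=(x_1,\dots,x_d)$. Symbolic powers: $I^{(n)}=\bigcap_{\mathfrak{p}\in\mathrm{Min}(I)}(I^nR_{\mathfrak{p}}\cap R)$, where $\mathrm{Min}(I)$ is the set of minimal primes of $I$. The analytic spread $\ell(L)$ of an ideal $L$ is the Krull dimension of $\bigoplus_{n\geqslant 0}L^n/\mathfrak{m}L^n$; the symbolic analytic spread $\ell_s(I)$ is the Krull dimension of $\bigoplus_{n\geqslant 0}I^{(n)}/\mathfrak{m}I^{(n)}$. For a squarefree monomial ideal $I$, the symbolic polyhedron $\mathrm{SP}(I)$ is the set of all points $(a_1,\dots,a_d)$ with nonnegative coordinates (in $\mathbb{R}^d$) such that $\sum_{x_i\in\mathfrak{p}}a_i\geqslant 1$ for every $\mathfrak{p}\in\mathrm{Min}(I)$. *)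

(* Defs.v *)
From HB Require Import structures.
From mathcomp Require Import all_boot all_order all_algebra.
From mathcomp Require Import ring_quotient fraction mpoly.
From mathcomp Require Import boolp classical_sets reals topology normedtype.

Set Implicit Arguments.
Unset Strict Implicit.
Unset Printing Implicit Defensive.

Import Order.TTheory GRing.Theory Num.Theory.
Import numFieldNormedType.Exports.
Local Open Scope ring_scope.
Local Open Scope quotient_scope.
Local Open Scope classical_set_scope.

(* Ideals are not required to be proper, so that I^0 is one of them. *)
Record ideal (A : comNzRingType) := Ideal {
  ideal_set :> A -> Prop;
  ideal0 : ideal_set 0;
  idealD : forall x y, ideal_set x -> ideal_set y -> ideal_set (x + y);
  idealM : forall a x, ideal_set x -> ideal_set (a * x) }.

Section Ideals.
Variable A : comNzRingType.
Implicit Types (I J p q : ideal A) (S : set A).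

Definition ideal_gen_set S : set A :=
  [set x | forall J, S `<=` J -> J x].

Program Definition ideal_gen S : ideal A := @Ideal A (ideal_gen_set S) _ _ _.
Next Obligation. by move=> S J _; exact: ideal0. Qed.
Next Obligation. by move=> S x y Sx Sy J SJ; apply: idealD; [exact: Sx|exact: Sy]. Qed.
Next Obligation. by move=> S a x Sx J SJ; apply: idealM; exact: Sx. Qed.

Definition ideal_mul I J : ideal A :=
  ideal_gen [set x * y | x in (I : set A) & y in (J : set A)].

Fixpoint ideal_pow I n : ideal A :=
  if n is n'.+1 then ideal_mul I (ideal_pow I n') else ideal_gen setT.

Definition is_prime p := ~ p 1 /\ forall x y, p (x * y) -> p x \/ p y.

Definition minimal_prime I : set (ideal A) :=
  [set p | [/\ is_prime p, I `<=` p &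
    forall q, is_prime q -> I `<=` q -> q `<=` p -> p `<=` q]].

Definition prime_chain n (P : nat -> ideal A) :=
  (forall i, (i <= n)%N -> is_prime (P i)) /\
  (forall i, (i < n)%N -> P i `<` P i.+1).

(* A has (finite) Krull dimension n *)
Definition krull_dim n :=
  (exists P, prime_chain n P) /\ (forall m P, prime_chain m P -> (m <= n)%N).

Lemma idealN I x : I x -> I (- x).
Proof. by rewrite -mulN1r; exact: idealM. Qed.

Lemma ideal_sum I (T : Type) (r : seq T) (P : pred T) (F : T -> A) :
  (forall i, P i -> I (F i)) -> I (\sum_(i <- r | P i) F i).
Proof.
by move=> IF; elim/big_ind: _ => //; [exact: ideal0|exact: idealD].
Qed.

Lemma ideal_genP S : S `<=` ideal_gen S.
Proof. by move=> x Sx J; exact. Qed.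

Lemma ideal_gen_min S J : S `<=` J -> ideal_gen S `<=` J.
Proof. by move=> SJ x; exact. Qed.

Program Definition colon J y : ideal A := @Ideal A [set x | J (x * y)] _ _ _.
Next Obligation. by move=> J y /=; rewrite mul0r; exact: ideal0. Qed.
Next Obligation. by move=> J y x z /= Jx Jz; rewrite mulrDl; exact: idealD. Qed.
Next Obligation. by move=> J y a x /= Jx; rewrite -mulrA; exact: idealM. Qed.

Lemma ideal_mul_in I J x y : I x -> J y -> ideal_mul I J (x * y).
Proof. by move=> Ix Jy; apply: ideal_genP; exists x => //; exists y. Qed.

Lemma ideal_mul_subr I J : ideal_mul I J `<=` J.
Proof. by apply: ideal_gen_min => _ [x Ix] [y Jy] <-; exact: idealM. Qed.

Lemma ideal_mul_subl I J : ideal_mul I J `<=` I.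
Proof.
by apply: ideal_gen_min => _ [x Ix] [y Jy] <-; rewrite mulrC; exact: idealM.
Qed.

Lemma ideal_mulA I J J' L x y :
    (forall u v, J u -> J' v -> (L : ideal A) (u * v)) ->
  ideal_mul I J x -> J' y -> ideal_mul I L (x * y).
Proof.
move=> JL Ix J'y; suff: ideal_mul I J `<=` colon (ideal_mul I L) y by apply.
apply: ideal_gen_min => _ [u Iu] [v Jv] <- /=.
by rewrite -mulrA; apply: ideal_mul_in => //; exact: JL.
Qed.

Lemma ideal_powD I m n x y :
  ideal_pow I m x -> ideal_pow I n y -> ideal_pow I (m + n) (x * y).
Proof.
elim: m x y => [|m IH] x y Ix Iy; first exact: idealM.
by apply: ideal_mulA Ix Iy => u v Iu Iv; exact: IH.
Qed.

End Ideals.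

Record filtration (A : comNzRingType) := Filtration {
  fil :> nat -> ideal A;
  fil0 : forall x, fil 0%N x;
  filM : forall m n x y, fil m x -> fil n y -> fil (m + n)%N (x * y) }.

Program Definition pow_filtration (A : comNzRingType) (I : ideal A) :=
  @Filtration A (ideal_pow I) _ _.
Next Obligation. by move=> A I x; exact: ideal_genP. Qed.
Next Obligation. by move=> A I m n x y; exact: ideal_powD. Qed.

Section SymbolicPowers.
Variable A : idomainType.
Implicit Types (I J p : ideal A).

(* The extension J A_p, inside the fraction field of the domain A. *)
Definition loc_ext J p : set {fraction A} :=
  [set z | exists a s, [/\ J a, ~ p s & z = tofrac a / tofrac s]].

Definition symb_pow_set I n : set A :=
  [set f | forall p, minimal_prime I p -> loc_ext (ideal_pow I n) p (tofrac f)].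

Lemma loc_extP J p (f : A) : is_prime p ->
  loc_ext J p (tofrac f) <-> exists2 s, ~ p s & J (s * f).
Proof.
move=> [p1 pM]; split=> [[a] [s] [Ja ps]|[s ps Jsf]].
  have s0 : s != 0 by apply: contra_notN ps => /eqP ->; exact: ideal0.
  move=> /(congr1 ( *%R^~ (tofrac s))); rewrite divfK ?tofrac_eq0//.
  by rewrite -tofracM => /eqP; rewrite tofrac_eq => /eqP fsa; exists s => //; rewrite mulrC fsa.
have s0 : s != 0 by apply: contra_notN ps => /eqP ->; exact: ideal0.
exists (s * f), s; split => //.
by rewrite tofracM mulrC mulKf// tofrac_eq0.
Qed.

Program Definition symb_pow I n : ideal A := @Ideal A (symb_pow_set I n) _ _ _.
Next Obligation.
move=> I n p [[p1 pM] _ _]; apply/loc_extP => //.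
by exists 1 => //; rewrite mulr0; exact: ideal0.
Qed.
Next Obligation.
move=> I n x y Ix Iy p pI; have [pp _ _] := pI.
have /(loc_extP _ _ pp)[s ps Is] := Ix p pI.
have /(loc_extP _ _ pp)[t pt It] := Iy p pI.
apply/(loc_extP _ _ pp); exists (s * t); first by case/pp.2.
rewrite mulrDr; apply: idealD; last by rewrite -mulrA; exact: idealM.
by rewrite mulrAC mulrC; exact: idealM.
Qed.
Next Obligation.
move=> I n a x Ix p pI; have [pp _ _] := pI.
have /(loc_extP _ _ pp)[s ps Is] := Ix p pI.
by apply/(loc_extP _ _ pp); exists s => //; rewrite mulrCA; exact: idealM.
Qed.

Program Definition symb_filtration I := @Filtration A (symb_pow I) _ _.
Next Obligation.
move=> I x p [pp _ _]; apply/(loc_extP _ _ pp); exists 1; first exact: pp.1.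
exact: ideal_genP.
Qed.
Next Obligation.
move=> I m n x y Ix Iy p pI; have [pp _ _] := pI.
have /(loc_extP _ _ pp)[s ps Is] := Ix p pI.
have /(loc_extP _ _ pp)[t pt It] := Iy p pI.
apply/(loc_extP _ _ pp); exists (s * t); first by case/pp.2.
by rewrite mulrACA; exact: ideal_powD.
Qed.

End SymbolicPowers.

(* The Rees algebra \bigoplus_n F_n, as the subring of A[t] of the polynomials
   whose coefficient of t^n lies in F_n. *)
Section ReesAlgebra.
Variables (A : comNzRingType) (F : filtration A).

Definition rees_pred : pred {poly A} := fun f => `[< forall n, F n f`_n >].

Lemma rees_subring : GRing.subring_closed rees_pred.
Proof.
split=> [|f g /asboolP Ff /asboolP Fg|f g /asboolP Ff /asboolP Fg];
  apply/asboolP => n.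
- by rewrite coef1; case: n => [|n]; [exact: fil0|exact: ideal0].
- by rewrite coefB; apply: idealD => //; exact: idealN.
- rewrite coefM; apply: ideal_sum => i _.
  by have := filM (Ff i) (Fg (n - i)%N); rewrite subnKC// -ltnS.
Qed.

HB.instance Definition _ :=
  GRing.isSubringClosed.Build {poly A} rees_pred rees_subring.

Record rees := Rees { rees_val :> {poly A}; _ : rees_val \in rees_pred }.

HB.instance Definition _ := [isSub for rees_val].
HB.instance Definition _ := [Choice of rees by <:].
HB.instance Definition _ := [SubChoice_isSubComNzRing of rees by <:].

End ReesAlgebra.

Section FiberRing.
Variables (K : fieldType) (d : nat).
Local Notation A := {mpoly K[d]}.

Definition max_ideal : ideal A := ideal_gen [set 'X_i | i in [set: 'I_d]].

Program Definition mcoeff0_ideal : ideal A :=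
  @Ideal A [set f | f@_0%MM = 0] _ _ _.
Next Obligation. exact: mcoeff0. Qed.
Next Obligation. by move=> f g /= f0 g0; rewrite mcoeffD f0 g0 addr0. Qed.
Next Obligation.
by move=> f g /= g0; rewrite -[LHS]/(mcoeff 0%MM _) rmorphM /= g0 mulr0.
Qed.

Lemma max_ideal1 : ~ max_ideal 1.
Proof.
suff mc : max_ideal `<=` mcoeff0_ideal.
  by move/mc => /=; rewrite mcoeff1 eqxx => /eqP; rewrite oner_eq0.
apply: ideal_gen_min => _ [i _ <-] /=; rewrite mcoeffX.
by case: eqP => // /(congr1 (@mdeg d)); rewrite mdeg1 mdeg0.
Qed.

Variable F : filtration A.

(* The ideal \bigoplus_n \mathfrak{m} F_n of \bigoplus_n F_n. *)
Definition fiber_pred : pred (rees F) :=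
  fun f => `[< forall n, ideal_mul max_ideal (F n) (rees_val f)`_n >].

Lemma fiber_ideal : idealr_closed fiber_pred.
Proof.
split.
- by apply/asboolP => n; rewrite coef0; exact: ideal0.
- apply/asboolP => /(_ 0%N); rewrite coef1 => /ideal_mul_subl.
  exact: max_ideal1.
- move=> a f g /asboolP mf /asboolP mg; apply/asboolP => n.
  rewrite coefD coefM; apply: idealD; last exact: mg.
  apply: ideal_sum => i _; rewrite mulrC.
  apply: (@ideal_mulA _ max_ideal (F (n - i)%N) (F i)) => //.
    by move=> u v Fu Fv; have := filM Fu Fv; rewrite subnK// -ltnS.
  by case: a => a /= /asboolP.
Qed.

HB.instance Definition _ :=
  isIdealr.Build (rees F) fiber_pred fiber_ideal.

(* \bigoplus_n F_n / \mathfrak{m} F_n, as a quotient of \bigoplus_n F_n. *)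
Definition fiber_ring : comNzRingType :=
  {ideal_quot (fiber_pred : idealr (rees F))}.

End FiberRing.

Definition analytic_spread (K : fieldType) d (L : ideal {mpoly K[d]}) (l : nat) :=
  krull_dim (fiber_ring (pow_filtration L)) l.

Definition symbolic_analytic_spread (K : fieldType) d (I : ideal {mpoly K[d]})
    (l : nat) :=
  krull_dim (fiber_ring (symb_filtration I)) l.

Definition squarefree_monomial (K : fieldType) d (I : ideal {mpoly K[d]}) :=
  exists2 S : set 'X_{1..d}, (forall m, S m -> forall i, (m i <= 1)%N) &
    I = ideal_gen [set 'X_[m] | m in S] :> set {mpoly K[d]}.

Definition symbolic_polyhedron (R : realType) (K : fieldType) d
    (I : ideal {mpoly K[d]}) : set 'rV[R]_d :=
  [set a | (forall i, 0 <= a 0 i) /\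
    forall p, minimal_prime I p -> 1 <= \sum_(i < d | `[< p 'X_i >]) a 0 i].

Arguments symbolic_polyhedron R {K d} I.

Section Faces.
Variables (R : realType) (d : nat).
Implicit Types (P F : set 'rV[R]_d) (u x : 'rV[R]_d).

(* Nonempty faces; P itself is one (u = 0). *)
Definition face P F :=
  F !=set0 /\
  exists u c, (forall x, P x -> c <= \sum_i u 0 i * x 0 i) /\
    F = [set x | P x /\ \sum_i u 0 i * x 0 i = c].

Definition affine_hull F : set 'rV[R]_d :=
  [set x | exists n (t : 'I_n -> R) (y : 'I_n -> 'rV[R]_d),
    [/\ forall i, F (y i), \sum_i t i = 1 & x = \sum_i t i *: y i]].

Definition affine_dim F (k : nat) :=
  exists x0 (V : {vspace 'rV[R]_d}),
    affine_hull F = [set x0 + v | v in [set v | v \in V]] /\ \dim V = k.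

Definition max_compact_face_dim P (k : nat) :=
  (exists F, [/\ face P F, compact F & affine_dim F k]) /\
  (forall F j, face P F -> compact F -> affine_dim F j -> (j <= k)%N).

End Faces.

(* Main.v *)
Require Import Defs.
From HB Require Import structures.
From mathcomp Require Import all_boot all_order all_algebra.
From mathcomp Require Import ring_quotient mpoly zify lra.
From mathcomp Require Import boolp classical_sets reals topology normedtype.

Set Implicit Arguments.
Unset Strict Implicit.
Unset Printing Implicit Defensive.

Import Order.TTheory GRing.Theory Num.Theory.
Import numFieldNormedType.Exports.
Local Open Scope ring_scope.
Local Open Scope quotient_scope.
Local Open Scope classical_set_scope.

(** Let p_C = (x_i : i in C), C in CC, be the minimal primes of I.  A monomial x^m
    lies in I^(n) iff sum_(i in C) m_i >= n for every C in CC, and it is a minimal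
    generator iff every i with m_i > 0 lies in some C in CC for which equality
    holds, that is, iff m/n lies on a compact face of SP(I).  So the minimal
    generators of the I^(gn) form a basis of the fiber ring of n |-> I^(gn), and a
    product of two of them is either their product as monomials or 0, according to
    whether they lie on a common compact face.  For every g > 0 the Krull dimension
    of this ring is 1 + k, where k is the largest dimension of a compact face:
    - at most 1 + k, because the minimal generators of degree <= D number
      O(D^(k+1)), so that any k + 2 elements are algebraically dependent, whereas
      elements x_i in P_(i+1) \ P_i along a chain of primes are algebraically
      independent modulo P_0;
    - at least 1 + k, because the fiber ring maps onto the monoid algebra of a
      k-dimensional compact face, and there one may set to 1, one after the other,
      k coordinates that are independent on the face, and finally send t to 0.
    By Dickson's lemma the monoid of the pairs (m, n) with x^m in I^(n) is finitely
    generated, hence (I^(g))^n = I^(gn) for some g > 0 and all n.  As the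
    constraints defining SP(I) are rational, every tight set of constraints
    attained at a real point of SP(I) is attained at some m/n. *)

(** * Monomial ideals *)

(* The order in z of the result is the least wdeg a m over the monomials m of f :
   a = 1_C gives the p_C-adic order, a = face_wt detects a face of SP(I). *)
HB.lock Definition wsubst (K : fieldType) d (a : 'I_d -> nat) (S : {set 'I_d}) :
    {mpoly K[d]} -> {poly {mpoly K[d]}} :=
  mmap (polyC \o @mpolyC d K)
       (fun i => (if i \in S then 'X_i else 1 : {mpoly K[d]})%:P * 'X^(a i)).
Canonical wsubst_unlockable := Unlockable wsubst.unlock.
Arguments wsubst {K d} a S.

Lemma wsubst_zmod_morphism (K : fieldType) d a S : zmod_morphism (@wsubst K d a S).
Proof. by move=> f f'; rewrite unlock rmorphB. Qed.

Lemma wsubst_monoid_morphism (K : fieldType) d a S : monoid_morphism (@wsubst K d a S).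
Proof. by split=> [|f f']; rewrite unlock ?rmorph1 ?rmorphM. Qed.

Section MonomialIdeals.
Variables (K : fieldType) (d : nat).
Local Notation A := {mpoly K[d]}.
Implicit Types (f g : A) (m u : 'X_{1..d}) (J : ideal A) (C S : {set 'I_d}).

Lemma ideal_of_msupp J f : (forall m, m \in msupp f -> J 'X_[m]) -> J f.
Proof.
move=> Jf; rewrite (mpolyE f) big_seq; apply: ideal_sum => m mf.
by rewrite -mul_mpolyC; apply: idealM; exact: Jf.
Qed.

Section MonIdeal.
Variable Q : 'X_{1..d} -> Prop.
Hypothesis Q_up : forall u m, Q m -> Q (u + m)%MM.

Program Definition mon_ideal : ideal A :=
  @Ideal A [set f | forall m, m \in msupp f -> Q m] _ _ _.
Next Obligation. by move=> /= m; rewrite msupp0. Qed.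
Next Obligation.
by move=> f g Qf Qg m /msuppD_le; rewrite mem_cat => /orP[/Qf|/Qg].
Qed.
Next Obligation.
move=> f g Qg m /msuppM_le /allpairsP[[u v] /= [uf vg ->]].
by apply: Q_up; exact: Qg.
Qed.

Lemma mon_idealX m : mon_ideal 'X_[m] <-> Q m.
Proof.
by split=> [|Qm u]; [apply; rewrite msuppX mem_head | rewrite msuppX inE => /eqP->].
Qed.

End MonIdeal.

Definition wdeg (a : 'I_d -> nat) m : nat := \sum_i a i * m i.

Definition csum C m : nat := \sum_(i in C) m i.

Definition mrestr S m : 'X_{1..d} := [multinom (if i \in S then m i else 0)%N | i < d].

Lemma csumD C m u : csum C (m + u)%MM = (csum C m + csum C u)%N.
Proof. by rewrite -big_split /=; apply: eq_bigr => i _; rewrite mnmDE. Qed.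

Lemma csumU C i : csum C U_(i)%MM = (i \in C).
Proof.
rewrite /csum (eq_bigr (fun j => (i == j) : nat)) => [|j _]; last exact: mnm1E.
case: (boolP (i \in C)) => iC.
  by rewrite (bigD1 i) //= eqxx big1 ?addn0 // => j /andP[_ /negPf]; rewrite eq_sym => ->.
by rewrite big1 // => j jC; case: eqP => // ij; rewrite ij jC in iC.
Qed.

Lemma csum_wdeg C m : csum C m = wdeg (fun i => i \in C) m.
Proof.
by rewrite /csum big_mkcond; apply: eq_bigr => i _; case: (i \in C); rewrite ?mul1n.
Qed.

Lemma csum_ge C m i : i \in C -> (m i <= csum C m)%N.
Proof. by move=> iC; rewrite /csum (bigD1 i) //= leq_addr. Qed.

Lemma csum_gt0 C m : (0 < csum C m)%N -> exists2 i, i \in C & (0 < m i)%N.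
Proof.
rewrite lt0n sum_nat_eq0 negb_forall => /existsP[i].
by rewrite negb_imply -lt0n => /andP[]; exists i.
Qed.

HB.instance Definition _ a S := GRing.isZmodMorphism.Build A {poly A} (wsubst a S)
  (@wsubst_zmod_morphism K d a S).
HB.instance Definition _ a S := GRing.isMonoidMorphism.Build A {poly A} (wsubst a S)
  (@wsubst_monoid_morphism K d a S).

(** [wsubst] sends x^m, with x_i := 1 outside S, to that monomial times t^(wdeg a m), so each
    coefficient collects one weighted degree. *)
Lemma wsubst_coef a S f n :
  (wsubst a S f)`_n =
  \sum_(m <- msupp f | wdeg a m == n) f@_m *: 'X_[mrestr S m].
Proof.
rewrite unlock /mmap coef_sum [RHS]big_mkcond; apply: eq_bigr => m _.
have -> : mmap1 (fun i => (if i \in S then 'X_i else 1 : A)%:P * 'X^(a i)) m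
          = ('X_[mrestr S m])%:P * 'X^(wdeg a m).
  rewrite /mmap1 mpolyXE_id rmorph_prod -prodrXr -big_split /=.
  apply: eq_bigr => i _; rewrite exprMn -exprM; congr (_ * _).
  by rewrite mnmE; case: (i \in S); rewrite ?expr0 -rmorphXn /= ?expr1n.
rewrite /= mulrA -polyCM coefCM coefXn eq_sym mul_mpolyC.
by case: eqP; rewrite ?mulr1 ?mulr0.
Qed.

Lemma mrestrT m : mrestr [set: _]%SET m = m.
Proof. by apply/mnmP => i; rewrite mnmE inE. Qed.

Lemma wsubst_low a S f n :
  (forall m, m \in msupp f -> (n <= wdeg a m)%N) ->
  forall k, (k < n)%N -> (wsubst a S f)`_k = 0.
Proof.
move=> fn k kn; rewrite wsubst_coef big_seq_cond big1 // => m /andP[/fn + /eqP mk].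
by rewrite mk leqNgt kn.
Qed.

(** With S full, distinct monomials stay distinct, so nothing cancels and f can be read off its
    image. *)
Lemma wsubstT_mcoeff a f m : ((wsubst a [set: _]%SET f)`_(wdeg a m))@_m = f@_m.
Proof.
rewrite wsubst_coef raddf_sum /= big_mkcond /=.
rewrite (eq_bigr (fun u : 'X_{1..d} => f@_u * (u == m)%:R)) => [|u _]; last first.
  rewrite mcoeffZ mrestrT mcoeffX; case: (u =P m) => [->|_]; first by rewrite eqxx.
  by rewrite mulr0; case: ifP.
case: (boolP (m \in msupp f)) => mf.
  rewrite (bigD1_seq m) ?msupp_uniq //= eqxx mulr1 big1 ?addr0 // => u /negPf ->.
  by rewrite mulr0.
rewrite big_seq_cond big1 => [|u /andP[uf _]]; first by rewrite memN_msupp_eq0.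
by case: eqP => [E|_]; rewrite ?mulr0 //; rewrite -E uf in mf.
Qed.

Lemma wsubstT_low a f n :
  (forall k, (k < n)%N -> (wsubst a [set: _]%SET f)`_k = 0) ->
  forall m, m \in msupp f -> (n <= wdeg a m)%N.
Proof.
move=> fn m mf; rewrite leqNgt; apply/negP => /fn E.
by move: mf; rewrite mcoeff_msupp -(wsubstT_mcoeff a) E mcoeff0 eqxx.
Qed.

End MonomialIdeals.

(** * Lowest coefficients, and symbolic powers of squarefree monomial ideals *)

Section LowCoef.
Variable B : idomainType.
Implicit Types p q : {poly B}.

Lemma low_coefM p q n k :
  (forall i, (i < n)%N -> p`_i = 0) -> (forall i, (i < k)%N -> q`_i = 0) ->
  (p * q)`_(n + k) = p`_n * q`_k.
Proof.
move=> pn qk; rewrite coefM.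
have nk : (n < (n + k).+1)%N by lia.
rewrite (bigD1 (Ordinal nk)) //= addKn big1 ?addr0 // => i /eqP/val_eqP /= ni.
have [lt|] := ltnP i n; first by rewrite pn ?mul0r.
by move=> ge; rewrite qk ?mulr0 //; have := ltn_ord i; lia.
Qed.

(** Lowest coefficients multiply in a domain, so a factor of order 0 can be cancelled from an order
    estimate. For the p_C-adic order this removes denominators outside p_C. *)
Lemma low_coef_cancel p q n : p`_0 != 0 ->
  (forall i, (i < n)%N -> (p * q)`_i = 0) -> forall i, (i < n)%N -> q`_i = 0.
Proof.
move=> p0 pq i; elim/ltn_ind: i => i IH lt_in.
have := pq i lt_in; rewrite -[i in LHS]add0n low_coefM //.
  by move/eqP; rewrite mulf_eq0 (negPf p0) => /eqP.
by move=> j ji; apply: IH => //; exact: ltn_trans lt_in.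
Qed.

End LowCoef.

Section SymbolicPowersOfSquarefree.
Variables (K : fieldType) (d : nat).
Local Notation A := {mpoly K[d]}.
Implicit Types (f : A) (m : 'X_{1..d}) (C : {set 'I_d}).

Definition var_set (p : ideal A) : {set 'I_d} := [set i | `[< p 'X_i >]]%SET.

Lemma in_var_set p i : (i \in var_set p) = `[< p 'X_i >].
Proof. by rewrite inE. Qed.

Lemma csum_up C n u m : (n <= csum C m -> n <= csum C (u + m)%MM)%N.
Proof. by rewrite csumD => /leq_trans; apply; exact: leq_addl. Qed.

(* The ideal (x_i : i in C)^n. *)
Definition var_ideal C n : ideal A := @mon_ideal K d _ (@csum_up C n).

Lemma var_ideal_coefP C n f :
  var_ideal C n f <->
  forall k, (k < n)%N -> (wsubst (fun i => i \in C) [set: _]%SET f)`_k = 0.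
Proof.
split=> [Cf|fC m mf].
  by apply: wsubst_low => m /Cf; rewrite csum_wdeg.
by rewrite csum_wdeg; exact: wsubstT_low mf.
Qed.

Lemma var_ideal1 C f :
  var_ideal C 1 f <-> (wsubst (fun i => i \in C) [set: _]%SET f)`_0 = 0.
Proof. by split=> [/var_ideal_coefP -> //|E]; apply/var_ideal_coefP => -[]. Qed.

Lemma var_ideal_prime C : is_prime (var_ideal C 1).
Proof.
split=> [/var_ideal1|f g /var_ideal1].
  by rewrite rmorph1 coef1 => /eqP; rewrite oner_eq0.
rewrite rmorphM coef0M => /eqP; rewrite mulf_eq0.
by case/orP=> /eqP E; [left|right]; apply/var_ideal1.
Qed.

Lemma primeX_csum (p : ideal A) m : is_prime p -> p 'X_[m] -> (0 < csum (var_set p) m)%N.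
Proof.
move=> [p1 pM]; rewrite mpolyXE_id => pm.
have [i pi mi] : exists2 i, p 'X_i & (0 < m i)%N.
  elim: (index_enum _) pm => [|i s IH]; first by rewrite big_nil.
  rewrite big_cons => /pM[|//] pi; exists i.
    by elim: (m i) pi => [|k IHk]; rewrite ?expr0 // exprS => /pM[].
  by case: (m i) pi => //; rewrite expr0.
apply: leq_trans mi (csum_ge _ _); by rewrite in_var_set; apply/asboolP.
Qed.

Lemma var_ideal_sub (p : ideal A) C : C \subset var_set p -> var_ideal C 1 `<=` p.
Proof.
move=> /fintype.subsetP Cp f fC; apply: ideal_of_msupp => m /fC /csum_gt0[i /Cp].
rewrite in_var_set => /asboolP pi mi.
have -> : m = ((m - U_(i)) + U_(i))%MM by rewrite submK // lep1mP -lt0n.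
by rewrite mpolyXD; exact: idealM.
Qed.

Lemma var_set_ideal C : var_set (var_ideal C 1) = C.
Proof.
apply/setP => i; rewrite in_var_set; apply/asboolP/idP => [/mon_idealX|iC].
  by rewrite csumU; case: (i \in C).
by apply/mon_idealX; rewrite csumU iC.
Qed.

Variable I : ideal A.

Definition min_covers : {set {set 'I_d}} :=
  [set C | `[< exists2 p, minimal_prime I p & C = var_set p >]]%SET.

Lemma min_coversP C :
  reflect (exists2 p, minimal_prime I p & C = var_set p) (C \in min_covers).
Proof. by rewrite inE; exact: asboolP. Qed.

Hypothesis I_sqf : squarefree_monomial I.

(** A prime over I contains a variable of each monomial generator, so the variables in it already
    generate a prime over I. Minimal primes are therefore generated by variables. *)
Lemma sub_var_ideal (q : ideal A) :
  is_prime q -> I `<=` q -> I `<=` var_ideal (var_set q) 1.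
Proof.
have [S _ IE] := I_sqf; move=> qp Iq; rewrite IE; apply: ideal_gen_min => _ [m Sm <-].
apply/mon_idealX; apply: primeX_csum => //; apply: Iq.
by rewrite IE; apply: ideal_genP; exists m.
Qed.

Lemma minimal_primeE p : minimal_prime I p -> p = var_ideal (var_set p) 1 :> set A.
Proof.
move=> [pp Ip pmin]; apply/seteqP; split; last exact: var_ideal_sub.
by apply: pmin; [exact: var_ideal_prime|exact: sub_var_ideal|exact: var_ideal_sub].
Qed.

Lemma min_coversE C : C \in min_covers <-> minimal_prime I (var_ideal C 1).
Proof.
split=> [/min_coversP[p pI ->]|CI]; last first.
  by apply/min_coversP; exists (var_ideal C 1); rewrite ?var_set_ideal.
have E := minimal_primeE pI; case: pI => pp Ip pmin; split.
- exact: var_ideal_prime.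
- by rewrite -E.
- by rewrite -E.
Qed.

Lemma min_covers_sub C : C \in min_covers -> I `<=` var_ideal C 1.
Proof. by move=> /min_coversE[]. Qed.

Lemma min_covers_gt0 C : (exists f, I f /\ f <> 0) -> C \in min_covers -> C != finset.set0.
Proof.
move=> [f [If /eqP f0]] /min_covers_sub/(_ _ If) Cf; apply/eqP => C0.
have /Cf : mlead f \in msupp f by rewrite mlead_supp.
by rewrite C0 /csum big_set0.
Qed.

Lemma ideal_pow_csum (J : ideal A) C k n : (forall f, J f -> var_ideal C k f) ->
  ideal_pow J n `<=` var_ideal C (k * n).
Proof.
move=> JC; elim: n => [|n IH]; first by move=> f _ m _; rewrite muln0.
apply: (@ideal_gen_min _ _ (var_ideal C (k * n.+1))) => _ [x Jx] [y /IH Jy <-] m /msuppM_le /allpairsP[[u v] /= [xu yv ->]].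
by rewrite csumD mulnS; apply: leq_add; [exact: (JC _ Jx)|exact: Jy].
Qed.

(* Minimality of p_C gives, for i in C, a squarefree generator of I meeting C
   in x_i only. *)
Lemma min_covers_private C i : C \in min_covers -> i \in C ->
  exists2 u : 'X_{1..d}, csum C u = 0%N & I 'X_[(U_(i) + u)].
Proof.
move=> /min_coversE CI iC; have [S S1 IE] := I_sqf.
have [m Sm mC] : exists2 m, S m & csum (C :\ i) m = 0%N.
  apply: contrapT => H.
  have ICi : I `<=` var_ideal (C :\ i) 1.
    rewrite IE; apply: ideal_gen_min => _ [m Sm <-]; apply/mon_idealX.
    by rewrite lt0n; apply: contra_notN H => /eqP E; exists m.
  have CiC : var_ideal (C :\ i) 1 `<=` var_ideal C 1.
    by apply: var_ideal_sub; rewrite var_set_ideal subD1set.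
  have [_ _ /(_ _ (@var_ideal_prime _) ICi CiC 'X_i) sub] := CI.
  have /sub/mon_idealX : var_ideal C 1 'X_i by apply/mon_idealX; rewrite csumU iC.
  by rewrite csumU !inE eqxx.
have Im : I 'X_[m] by rewrite IE; apply: ideal_genP; exists m.
have mi : m i = 1%N.
  apply/eqP; rewrite eqn_leq S1 //=.
  have /min_coversE /min_covers_sub/(_ _ Im) := CI.
  by move/mon_idealX; rewrite /csum (big_setD1 i) //= -/(csum _ m) mC addn0.
have Em : (U_(i) + (m - U_(i)))%MM = m by rewrite addmC submK // lep1mP mi.
exists (m - U_(i))%MM; last by rewrite Em.
by move/(congr1 (csum C)): Em; rewrite csumD csumU iC /csum [RHS](big_setD1 i) //= -!/(csum _ _) mC mi; lia.
Qed.

(** Locally at p_C the ideals I and p_C agree. One inclusion cancels a denominator of p_C-order 0,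
    the other exhibits a denominator. *)
Lemma symb_powP n f :
  symb_pow I n f <-> forall C, C \in min_covers -> var_ideal C n f.
Proof.
split=> [If C|If p pI].
  move=> CI; have pI : minimal_prime I (var_ideal C 1) by apply/min_coversE.
  have [pp _ _] := pI; have [s sp /(ideal_pow_csum (min_covers_sub CI))] :=
    (loc_extP _ _ pp).1 (If _ pI).
  rewrite mul1n => /var_ideal_coefP sf; apply/var_ideal_coefP.
  apply: (@low_coef_cancel _ (wsubst (fun i => i \in C) [set: _]%SET s)).
    by apply: contra_notN sp => /eqP sp; apply/var_ideal1.
  by move=> i /sf; rewrite rmorphM.
have [pp _ _] := pI; apply/loc_extP => //; set C := var_set p.
have CI : C \in min_covers by apply/min_coversP; exists p.
have /choice[u uP] i : exists u : 'X_{1..d}, i \in C ->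
    csum C u = 0%N /\ I 'X_[(U_(i) + u)].
  case: (boolP (i \in C)) => [iC|_]; last by exists (0%MM).
  by have [v v0 Iv] := min_covers_private CI iC; exists v.
(* x^s lies outside p_C and x_i x^s lies in I for every i in C, so the n-th power of x^s carries
   p_C^n into I^n. *)
pose s := (\sum_(i in C) u i)%MM; exists ('X_[s] ^+ n).
  rewrite mpolyXn; rewrite (minimal_primeE pI) => /mon_idealX.
  suff -> : csum C (s *+ n)%MM = 0%N by [].
  apply/eqP; rewrite sum_nat_eq0; apply/forallP => j; apply/implyP => jC.
  rewrite mulmnE mnm_sumE big1 // => i iC; have [u0 _] := uP i iC.
  by apply/eqP; rewrite -leqn0 -u0 csum_ge.
suff main m : (n <= csum C m)%N -> ideal_pow I n ('X_[s] ^+ n * 'X_[m]).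
  rewrite mulrC; apply: (@ideal_of_msupp _ _ (colon (ideal_pow I n) _)) => m /(If _ CI) mC.
  by rewrite /= mulrC; exact: main.
elim: n m {If} => [|n IH] m mC; first exact: ideal_genP.
have [i iC mi] := csum_gt0 (leq_trans (ltn0Sn _) mC).
have Em : (U_(i) + (m - U_(i)))%MM = m by rewrite addmC submK // lep1mP -lt0n.
rewrite -Em mpolyXD exprS mulrACA; apply: ideal_mul_in.
  rewrite /s (bigD1 i) //= mpolyXD mulrC mulrA -mpolyXD mulrC.
  by apply: idealM; have [] := uP i iC.
by apply: IH; move: mC; rewrite -{1}Em csumD csumU iC.
Qed.

End SymbolicPowersOfSquarefree.

(** * The Veronese trick *)

(** Induction on n. [L0] handles the first n functions, and B bounds [c n] on [L0]: a point with
    [c n x] at least B is dominated by [L0], and each of the finitely many levels below B gets its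
    own list. *)
Lemma dickson (T : eqType) (c : nat -> T -> nat) n (P : T -> Prop) :
  exists L : seq T, (forall y, y \in L -> P y) /\
    forall x, P x -> exists2 y, y \in L & forall i, (i < n)%N -> (c i y <= c i x)%N.
Proof.
elim: n P => [|n IH] P.
  have [[x Px]|nP] := pselect (exists x, P x); last first.
    by exists [::]; split=> // x Px; case: nP; exists x.
  by exists [:: x]; split=> [y|y _]; [rewrite inE => /eqP->|exists x; rewrite ?mem_head].
have [L0 [L0P L0min]] := IH P; pose B := \max_(y <- L0) c n y.
have /choice[L LP] := fun v => IH (fun x => P x /\ c n x = v).
exists (L0 ++ flatten [seq L v | v <- iota 0 B]); split=> [y|x Px].
  rewrite mem_cat => /orP[/L0P//|/flatten_mapP[v _]].
  by have [Lv _] := LP v; move/Lv => [].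
have [lt|ge] := ltnP (c n x) B.
  have [_ /(_ x (conj Px erefl))[y yL yx]] := LP (c n x).
  have [/(_ y yL)[_ cy] _] := LP (c n x).
  exists y => [|i].
    rewrite mem_cat; apply/orP; right; apply/flatten_mapP.
    by exists (c n x) => //; rewrite mem_iota.
  by rewrite ltnS leq_eqVlt => /orP[/eqP ->|/yx//]; rewrite cy.
have [y yL yx] := L0min x Px; exists y => [|i]; first by rewrite mem_cat yL.
rewrite ltnS leq_eqVlt => /orP[/eqP ->|/yx//]; apply: leq_trans ge.
by rewrite /B; exact: (@leq_bigmax_seq _ _ predT (c n)).
Qed.

Section Veronese.
Variables (d : nat) (CC : {set {set 'I_d}}).
Implicit Types (a b m : 'X_{1..d}) (C : {set 'I_d}).

Definition deg_ge n m := forall C, C \in CC -> (n <= csum C m)%N.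

Lemma deg_ge_le n k m : (k <= n)%N -> deg_ge n m -> deg_ge k m.
Proof. by move=> kn nm C /nm; exact: leq_trans. Qed.

Lemma deg_geD n k a b : deg_ge n a -> deg_ge k b -> deg_ge (n + k) (a + b)%MM.
Proof. by move=> na kb C CC_; rewrite csumD leq_add ?na ?kb. Qed.

Lemma csum_le C a b : (forall i, a i <= b i)%N -> (csum C a <= csum C b)%N.
Proof. by move=> ab; apply: leq_sum. Qed.

Lemma deg_ge_up n a b : (a <= b)%MM -> deg_ge n a -> deg_ge n b.
Proof. by move=> /mnm_lepP ab na C /na /leq_trans; apply; exact: csum_le. Qed.

Lemma csumB C a b : (b <= a)%MM -> csum C (a - b)%MM = (csum C a - csum C b)%N.
Proof. by move=> ba; rewrite -{2}(submK ba) csumD addnK. Qed.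

Lemma deg_ge_generators : exists H : seq ('X_{1..d} * nat),
  (forall h : 'X_{1..d} * nat, h \in H -> (0 < h.2)%N /\ deg_ge h.2 h.1) /\
  forall n m, (0 < n)%N -> deg_ge n m -> exists2 h : 'X_{1..d} * nat, h \in H &
    [/\ (h.1 <= m)%MM, (h.2 <= n)%N & deg_ge (n - h.2) (m - h.1)%MM].
Proof.
(* The coordinates are the degree n, then the d exponents, then the slacks [csum C m - n]. Comparing
   slacks as well makes the difference of two comparable pairs satisfy all constraints again. *)
pose s := enum CC; pose c k (x : 'X_{1..d} * nat) : nat :=
  if k is k'.+1 then
    if (k' < d)%N then nth 0%N x.1 k' else (csum (nth finset.set0 s (k' - d)) x.1 - x.2)%N
  else x.2.
have [H [HP Hmin]] :=
  dickson c (d + size s).+1 (fun x => (0 < x.2)%N /\ deg_ge x.2 x.1).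
exists H; split=> // n m n0 nm; have [h hH hle] := Hmin (m, n) (conj n0 nm).
have [h0 hd] := HP h hH.
have hm : (h.1 <= m)%MM.
  apply/mnm_lepP => i; have := hle i.+1.
  rewrite /= ltn_ord !(mnm_nth 0%N); apply; rewrite ltnS.
  exact: leq_trans (ltn_ord i) (leq_addr _ _).
exists h => //; split=> //; first by have := hle 0%N; apply.
move=> C CC_; have Cs : C \in s by rewrite mem_enum.
rewrite csumB //; have := hle (d + index C s).+1; rewrite /=.
have -> : (d + index C s < d)%N = false by lia.
rewrite addKn nth_index // ltnS ltn_add2l index_mem => /(_ Cs).
by have := hd C CC_; have := nm C CC_; have := hle 0%N isT; rewrite /=; lia.
Qed.

(** Generators are split off until the degree is 0. What remains is then an arbitrary monomial,
    hence the inequality. *)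
Lemma deg_ge_combination (H : seq ('X_{1..d} * nat)) :
  (forall h : 'X_{1..d} * nat, h \in H -> (0 < h.2)%N /\ deg_ge h.2 h.1) ->
  (forall n m, (0 < n)%N -> deg_ge n m -> exists2 h : 'X_{1..d} * nat, h \in H &
    [/\ (h.1 <= m)%MM, (h.2 <= n)%N & deg_ge (n - h.2) (m - h.1)%MM]) ->
  forall n m, deg_ge n m -> exists c : 'X_{1..d} * nat -> nat,
    (\sum_(h <- undup H) c h * h.2)%N = n /\
    (\sum_(h <- undup H) h.1 *+ c h <= m)%MM.
Proof.
move=> HP Hgen n; elim/ltn_ind: n => n IH m nm.
have [n0|n0] := posnP n.
  exists (fun=> 0%N); split; first by rewrite n0 big1.
  by rewrite big1 //; apply/mnm_lepP => i; rewrite mnm0E.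
have [h hH [hm hn nhm]] := Hgen n m n0 nm; have [h0 _] := HP h hH.
have [|c [cn cm]] := IH (n - h.2)%N _ _ nhm; first by lia.
have hU : h \in undup H by rewrite mem_undup.
exists (fun x => c x + (x == h))%N; split.
  rewrite (eq_bigr (fun x => c x * x.2 + (x == h) * x.2)%N) => [|x _]; last exact: mulnDl.
  rewrite big_split /= cn (bigD1_seq h) ?undup_uniq //= eqxx big1 => [|x /negPf ->//].
  by lia.
apply/mnm_lepP => i; rewrite mnm_sumE.
rewrite (eq_bigr (fun x : 'X_{1..d} * nat => x.1 i * c x + (x == h) * x.1 i)%N) => [|x _]; last first.
  by rewrite mulmnE mulnDr [X in (_ + X)%N]mulnC.
rewrite big_split /= (bigD1_seq h (F := fun x : 'X_{1..d} * nat => (x == h) * x.1 i)%N) ?undup_uniq //=.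
rewrite eqxx [X in (_ + (_ + X))%N]big1 => [|x /negPf ->//].
move/mnm_lepP: cm => /(_ i); rewrite mnm_sumE mnmBE.
rewrite (eq_bigr (fun x : 'X_{1..d} * nat => x.1 i * c x)%N (F1 := fun x => (x.1 *+ c x)%MM i)) => [|x _]; last by rewrite mulmnE.
by move/mnm_lepP: hm => /(_ i); lia.
Qed.

Lemma deg_ge_sum (I : eqType) (r : seq I) (F : I -> 'X_{1..d}) (k : I -> nat) :
  (forall i, i \in r -> deg_ge (k i) (F i)) ->
  deg_ge (\sum_(i <- r) k i) (\sum_(i <- r) F i)%MM.
Proof.
elim: r => [|i r IH] Hr; first by move=> C _; rewrite !big_nil.
rewrite !big_cons; apply: deg_geD; first by apply: Hr; rewrite mem_head.
by apply: IH => j jr; apply: Hr; rewrite inE jr orbT.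
Qed.

Lemma deg_geMn n m k : deg_ge n m -> deg_ge (k * n) (m *+ k)%MM.
Proof.
elim: k => [|k IH] nm; first by move=> C _; rewrite mul0n.
by rewrite mulmS mulSn; apply: deg_geD => //; exact: IH.
Qed.

(* N is a common multiple of the degrees of the D - 1 generators : if m has degree
   at least D N, some generator h contributes at least N to it, and N / deg h
   copies of h can be split off. *)
Lemma deg_ge_split1 : exists N D, [/\ (0 < N)%N, (0 < D)%N &
  forall n m, (D * N <= n)%N -> deg_ge n m -> exists a b,
    [/\ m = (a + b)%MM, deg_ge N a & deg_ge (n - N) b]].
Proof.
have [H [HP Hgen]] := deg_ge_generators.
pose N := \prod_(h <- undup H) h.2; pose D := (size (undup H)).+1.
have N0 : (0 < N)%N.
  by rewrite /N big_seq; elim/big_ind: _ => // [x y|h]; rewrite ?muln_gt0 ?mem_undup;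
     [move=> -> ->|move=> /HP[]].
exists N, D; split=> // n m Dn nm.
have [c [cn cm]] := deg_ge_combination HP Hgen nm.
have [h hH hN] : exists2 h : 'X_{1..d} * nat, h \in undup H & (N <= c h * h.2)%N.
  apply: contrapT => nex.
  suff : (\sum_(h <- undup H) c h * h.2 <= size (undup H) * N)%N.
    by rewrite cn; move: Dn; rewrite /D mulSn; lia.
  rewrite -sum1_size big_distrl /= big_seq [leqRHS]big_seq; apply: leq_sum => h hH.
  by rewrite mul1n leqNgt; apply: contra_notN nex => /ltnW; exists h.
have [h0 hd] : (0 < h.2)%N /\ deg_ge h.2 h.1 by apply: HP; rewrite -mem_undup.
have [q Nq] : exists q, N = (q * h.2)%N.
  by exists (\prod_(x <- undup H | x != h) x.2); rewrite mulnC -bigD1_seq ?undup_uniq.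
have qc : (q <= c h)%N by rewrite -(leq_pmul2r h0) -Nq.
pose c' x := (c x - (x == h) * q)%N.
have cc' x : c x = (c' x + (x == h) * q)%N.
  by rewrite /c'; case: eqP => [->|_]; lia.
have am : (h.1 *+ q + \sum_(x <- undup H) x.1 *+ c' x <= m)%MM.
  apply: lepm_trans cm; apply/mnm_lepP => i.
  rewrite mnmDE !mnm_sumE.
  rewrite [leqRHS](eq_bigr (fun x : 'X_{1..d} * nat => (x.1 *+ c' x)%MM i + (x == h) * (x.1 i * q))%N) => [|x _]; last first.
    by rewrite !mulmnE {1}cc' mulnDr mulnCA.
  rewrite big_split /= (bigD1_seq h (F := fun x : 'X_{1..d} * nat => (x == h) * _)%N) ?undup_uniq //=.
  by rewrite eqxx mulmnE; lia.
have qm : (h.1 *+ q <= m)%MM := lepm_trans (lem_addr _ _) am.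
exists (h.1 *+ q)%MM, (m - h.1 *+ q)%MM; split.
- by rewrite addmC submK.
- by rewrite Nq; exact: deg_geMn.
have -> : (n - N)%N = (\sum_(x <- undup H) c' x * x.2)%N.
  rewrite -cn (eq_bigr (fun x : 'X_{1..d} * nat => c' x * x.2 + (x == h) * (q * x.2))%N) => [|x _]; last first.
    by rewrite {1}cc' mulnDl mulnA.
  rewrite big_split /= (bigD1_seq h (F := fun x : 'X_{1..d} * nat => (x == h) * _)%N) ?undup_uniq //=.
  by rewrite eqxx [X in (_ + (_ + X))%N]big1 => [|x /negPf ->//]; rewrite Nq; lia.
apply: (@deg_ge_up _ (\sum_(x <- undup H) x.1 *+ c' x)%MM).
  apply/mnm_lepP => i; move/mnm_lepP: am => /(_ i).
  by rewrite mnmDE mnmBE; lia.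
by apply: deg_ge_sum => x; rewrite mem_undup => /HP[_ xd]; exact: deg_geMn.
Qed.

(** With g = D N, a part of degree N is split off D times. Starting from degree at least 2g keeps D
    N available at every split. *)
Lemma deg_ge_split : exists2 g, (0 < g)%N &
  forall n m, deg_ge (g * n.+2) m ->
    exists a b, [/\ m = (a + b)%MM, deg_ge g a & deg_ge (g * n.+1) b].
Proof.
have [N [D [N0 D0 split1]]] := deg_ge_split1.
exists (D * N)%N => [|n m]; first by rewrite muln_gt0 D0.
suff H j k : (D * N + j * N <= k)%N -> deg_ge k m ->
    exists a b, [/\ m = (a + b)%MM, deg_ge (j * N) a & deg_ge (k - j * N) b].
  move=> km; have [|a [b [-> aD bD]]] := H D _ _ km; first by nia.
  by exists a, b; split=> //; apply: deg_ge_le bD; nia.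
elim: j k m => [|j IH] k m jk km.
  by exists 0%MM, m; rewrite mul0n subn0 add0m; split=> // C _.
have [|a [b [-> aN bk]]] := split1 k m _ km; first by lia.
have [|a' [b' [-> aN' bk']]] := IH _ _ _ bk; first by rewrite mulSn in jk; lia.
exists (a + a')%MM, b'; rewrite addmA mulSn; split=> //; first exact: deg_geD.
by apply: deg_ge_le bk'; lia.
Qed.

End Veronese.

Lemma symb_pow_veronese (K : fieldType) d (I : ideal {mpoly K[d]}) :
  squarefree_monomial I -> exists2 g, (0 < g)%N &
  forall n f, ideal_pow (symb_pow I g) n f <->
    forall m, m \in msupp f -> deg_ge (min_covers I) (g * n) m.
Proof.
move=> Isq; have [g g0 gsplit] := deg_ge_split (min_covers I); exists g => // n f.
have symbX k m : deg_ge (min_covers I) k m -> symb_pow I k 'X_[m].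
  by move=> km; apply/(symb_powP Isq) => C CI; apply/mon_idealX; exact: km.
split=> [If m mf C CI|fg].
  have sub f' : symb_pow I g f' -> var_ideal K C g f' by move=> /(symb_powP Isq); apply.
  exact: ideal_pow_csum sub _ If m mf.
apply: ideal_of_msupp => m /fg {f fg}; case: n => [_|n]; first exact: ideal_genP.
elim: n m => [|n IH] m gm.
  rewrite -[X in ideal_set _ X]mulr1; apply: ideal_mul_in; last exact: ideal_genP.
  by apply: symbX; rewrite -[g]muln1.
have [a [b [-> ag bg]]] := gsplit _ _ gm.
by rewrite mpolyXD; apply: ideal_mul_in; [exact: symbX|exact: IH].
Qed.

(** * Tight constraints *)

Section KernelCoordinates.
Variable (F : fieldType).

(** A basis matrix of the left kernel has an invertible square submatrix; the [c j] are its columns,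
    so these coordinates parametrize the kernel. *)
Lemma kernel_coords d p (B : 'M[F]_(d, p)) :
  exists c : 'I_(d - \rank B) -> 'I_d,
    (forall v : 'rV_d, v *m B = 0 -> (forall j, v 0 (c j) = 0) -> v = 0) /\
    (forall w, exists2 v : 'rV_d, v *m B = 0 & forall j, v 0 (c j) = w j).
Proof.
rewrite -mxrank_ker; set N := row_base (kermx B).
have Nfree : row_full N^T by rewrite /row_full mxrank_tr; exact: row_base_free.
pose c := fullrankfun Nfree.
have cu : colsub c N \in unitmx.
  rewrite -unitmx_tr; suff -> : (colsub c N)^T = rowsub c N^T by exact: fullrowsub_unit.
  by apply/matrixP => i j; rewrite !mxE.
have NB u : u *m N *m B = 0.
  by apply/sub_kermxP; rewrite (submx_trans (submxMl _ _)) // eq_row_base.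
have colsubE (u : 'rV_(\rank (kermx B))) j : (u *m N) 0 (c j) = (u *m colsub c N) 0 j.
  by rewrite !mxE; apply: eq_bigr => i _; rewrite !mxE.
exists c; split=> [v vB vc|w].
  have /submxP[u uN] : (v <= N)%MS by rewrite eq_row_base; apply/sub_kermxP.
  suff : u *m colsub c N = 0.
    by move/(canRL (mulmxK cu)) => u0; rewrite uN u0 !mul0mx.
  by apply/rowP => j; rewrite -colsubE -uN vc mxE.
exists ((\row_j w j) *m invmx (colsub c N) *m N); first exact: NB.
by move=> j; rewrite colsubE mulmxKV // mxE.
Qed.

(** The column of C is the indicator of C, or 0 when C is not in W. The left kernel is the direction
    space of the face where the constraints in W are tight, and [dirdim] is its dimension. *)
Definition dirmx d (W : {set {set 'I_d}}) : 'M[F]_(d, #|{set 'I_d}|) :=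
  \matrix_(i, j) ((enum_val j \in W) && (i \in enum_val j))%:R.

Lemma dirmxP d (W : {set {set 'I_d}}) (v : 'rV[F]_d) :
  v *m dirmx W = 0 <-> forall C, C \in W -> \sum_(i in C) v 0 i = 0.
Proof.
have E j : (v *m dirmx W) 0 j =
    if enum_val j \in W then \sum_(i in enum_val j) v 0 i else 0.
  rewrite mxE; case: ifP => jW; last first.
    by rewrite big1 // => i _; rewrite mxE jW mulr0.
  rewrite [RHS]big_mkcond; apply: eq_bigr => i _; rewrite mxE jW /=.
  by case: (_ \in _); rewrite ?mulr1 ?mulr0.
split=> [v0 C CW|Wv]; last first.
  by apply/rowP => j; rewrite E mxE; case: ifP => // /Wv.
by have := E (enum_rank C); rewrite v0 mxE enum_rankK CW.
Qed.

Definition dirdim d (W : {set {set 'I_d}}) : nat := (d - \rank (dirmx W))%N.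

End KernelCoordinates.

Arguments dirmx F {d} W.
Arguments dirdim F {d} W.

Lemma dirdim_le F d (W : {set {set 'I_d}}) : (dirdim F W <= d)%N.
Proof. exact: leq_subr. Qed.

(** The entries are 0 and 1, so the rank is the same over a larger field; this compares rational
    with real dimensions. *)
Lemma dirdim_map (F1 F2 : fieldType) (f : {rmorphism F1 -> F2}) d (W : {set {set 'I_d}}) :
  dirdim F2 W = dirdim F1 W.
Proof.
rewrite /dirdim -(mxrank_map f); congr (_ - \rank _)%N.
by apply/matrixP => i j; rewrite !mxE rmorph_nat.
Qed.

Section TightSets.
Variables (d : nat) (CC : {set {set 'I_d}}).
Implicit Types (m : 'X_{1..d}) (W : {set {set 'I_d}}).

(* The constraints of SP(I) that are tight at m/n ; a_i >= 0 is encoded as the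
   singleton {i}. *)
Definition tights n m : {set {set 'I_d}} :=
  ([set C in CC | csum C m == n] :|: [set [set i] | i in [set i | m i == 0]])%SET.

Definition covers W := forall i : 'I_d, exists2 C, C \in W & i \in C.

Lemma tightsP n m C : reflect
  ((C \in CC /\ csum C m = n) \/ exists2 i, C = [set i]%SET & m i = 0%N) (C \in tights n m).
Proof.
rewrite !inE; apply: (iffP orP) => -[].
- by move=> /andP[? /eqP]; left.
- by move=> /imsetP[i]; rewrite inE => /eqP; right; exists i.
- by move=> [-> ->]; rewrite eqxx; left.
- by move=> [i -> mi]; right; apply: imset_f; rewrite inE mi.
Qed.

Lemma csum1 i m : csum [set i]%SET m = m i.
Proof. by rewrite /csum big_set1. Qed.

Lemma covers_tights n m : covers (tights n m) <->
  forall i, (0 < m i)%N -> exists C, [/\ C \in CC, i \in C & csum C m = n].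
Proof.
split=> [cov i mi|cov i].
  have [C /tightsP[[CC_ Cn] iC|[j -> mj]]] := cov i; first by exists C.
  by rewrite inE => /eqP ij; rewrite ij mj in mi.
have [m0|mi] := posnP (m i).
  by exists [set i]%SET; rewrite ?set11 //; apply/tightsP; right; exists i.
by have [C [? ? ?]] := cov i mi; exists C => //; apply/tightsP; left.
Qed.

(** Dividing by x_i lowers [csum C m] by one exactly when C contains i, so it violates a constraint
    iff some such C is tight. Hence covering means being a minimal generator. *)
Lemma covers_minimal n m : deg_ge CC n m -> covers (tights n m) <->
  forall i, (0 < m i)%N -> ~ deg_ge CC n (m - U_(i))%MM.
Proof.
move=> nm; rewrite covers_tights; split=> [cov i mi|mmin i mi].
  have [C [CC_ iC Cn]] := cov i mi => /(_ _ CC_).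
  have Em : ((m - U_(i)) + U_(i))%MM = m by rewrite submK // lep1mP -lt0n.
  by rewrite -Cn -{1}Em csumD csumU iC addn1 ltnn.
apply: contrapT => nC; apply: (mmin i mi) => C CC_.
have Em : ((m - U_(i)) + U_(i))%MM = m by rewrite submK // lep1mP -lt0n.
have := nm C CC_; rewrite -{1}Em csumD csumU.
case: (boolP (i \in C)) => [iC|]; last by rewrite addn0.
rewrite addn1 leq_eqVlt => /orP[/eqP E|//].
by case: nC; exists C; rewrite E -{1}Em csumD csumU iC addn1.
Qed.

(** A singleton may stand for a tight cover or for a vanishing exponent. If both readings meet, then
    n = 0 and both sums vanish. *)
Lemma tights_csum n m m' C : deg_ge CC n m -> deg_ge CC n m' ->
  C \in tights n m -> C \in tights n m' -> csum C m = csum C m'.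
Proof.
move=> nm nm' /tightsP[[CC_ ->]|[i -> mi]] /tightsP[[CC' E]|[j E mj]] //.
- by have := nm _ CC_; have := nm' _ CC_; rewrite E csum1 mj leqn0 => /eqP ->.
- have := nm _ CC'; rewrite csum1 mi leqn0 => /eqP n0.
  by rewrite E n0.
- by move/set1_inj: E mi mj => ->; rewrite !csum1 => -> ->.
Qed.

Lemma tights_le n m i : covers (tights n m) -> (m i <= n)%N.
Proof.
move=> /covers_tights cov; have [->//|/cov[D [_ iD <-]]] := posnP (m i).
exact: csum_ge.
Qed.

Definition mrow (F : fieldType) m : 'rV[F]_d := \row_i (m i)%:R.

Lemma mrow_sum F m (C : {set _}) : \sum_(i in C) mrow F m 0 i = (csum C m)%:R.
Proof. by rewrite natr_sum; apply: eq_bigr => i _; rewrite mxE. Qed.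

(** Points with the same tight set differ by a kernel vector of [dirmx], hence are separated by
    [dirdim] coordinates. Padding to k coordinates makes the number uniform in W. *)
Lemma tights_coords k W : (dirdim rat W <= k <= d)%N ->
  exists c : 'I_k -> 'I_d, forall n m m',
    deg_ge CC n m -> deg_ge CC n m' -> tights n m = W -> tights n m' = W ->
    (forall j, m (c j) = m' (c j)) -> m = m'.
Proof.
move=> /andP[Wk kd]; have [c [cinj _]] := kernel_coords (dirmx rat W).
pose c' (j : 'I_k) := if insub (val j) is Some j' then c j' else widen_ord kd j.
exists c' => n m m' nm nm' mW mW' E.
have /cinj : (mrow rat m - mrow rat m') *m dirmx rat W = 0.
  apply/dirmxP => C CW; rewrite (eq_bigr (fun i => mrow rat m 0 i - mrow rat m' 0 i)); last first.
    by move=> i _; rewrite !mxE.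
  by rewrite sumrB !mrow_sum (tights_csum nm nm') ?subrr // ?mW ?mW'.
move=> H; have /rowP mm' : mrow rat m - mrow rat m' = 0.
  apply: H => j; have := E (widen_ord Wk j); rewrite /c' insubT //= => jd.
  have -> : Sub (val j) jd = j by apply/val_inj; rewrite SubK.
  by rewrite !mxE => ->; rewrite subrr.
apply/mnmP => i; have := mm' i; rewrite !mxE => /eqP.
by rewrite subr_eq0 eqr_nat => /eqP.
Qed.

End TightSets.

(** * A Krull dimension bound by counting *)

Section KrullUpperBound.
Variables (K : fieldType) (Q : comNzRingType) (emb : {rmorphism K -> Q}).
Implicit Types (x : nat -> Q) (c : seq nat -> K) (P : nat -> ideal Q).

Fixpoint exps (D n : nat) : seq (seq nat) :=
  if n is n'.+1 then [seq e :: l | e <- iota 0 D, l <- exps D n'] else [:: [::]].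

Fixpoint mon x (l : seq nat) : Q :=
  if l is e :: l' then x 0%N ^+ e * mon (fun i => x i.+1) l' else 1.

Definition polyval D n x c : Q := \sum_(l <- exps D n) emb (c l) * mon x l.

Lemma size_exps D n : size (exps D n) = (D ^ n)%N.
Proof. by elim: n => //= n IH; rewrite size_allpairs size_iota IH expnS. Qed.

Lemma exps_uniq D n : uniq (exps D n).
Proof.
elim: n => //= n IH; apply: allpairs_uniq; rewrite ?iota_uniq //.
by move=> [a l] [b k] _ _ [-> ->].
Qed.

Lemma polyvalS D n x c : polyval D n.+1 x c =
  \sum_(0 <= e < D) x 0%N ^+ e * polyval D n (fun i => x i.+1) (fun l => c (e :: l)).
Proof.
rewrite /polyval /= big_allpairs_dep /index_iota subn0; apply: eq_bigr => e _.
by rewrite mulr_sumr; apply: eq_bigr => l _; rewrite mulrCA.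
Qed.

Lemma prime_expM (p : ideal Q) a b e : is_prime p -> ~ p a -> p (a ^+ e * b) -> p b.
Proof.
move=> [p1 pM] pa; elim: e b => [|e IH] b; first by rewrite mul1r.
by rewrite exprSr -mulrA => /IH /pM[].
Qed.

(* If Q(x_0, ..., x_(n-1)) lies in P_0, then dividing by the largest power of
   x_0 and reducing modulo P_1 gives a relation for x_1, ..., x_(n-1). *)
Lemma chain_algindep D n x P c :
  (forall i, (i <= n)%N -> is_prime (P i)) ->
  (forall i, (i < n)%N -> [/\ P i `<=` P i.+1, P i.+1 (x i) & ~ P i (x i)]) ->
  P 0%N (polyval D n x c) -> forall l, l \in exps D n -> c l = 0.
Proof.
elim: n x P c => [|n IH] x P c Ppr Px.
  rewrite /polyval /= big_seq1 mulr1 => Pc l; rewrite inE => /eqP ->.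
  apply: contrapT => /eqP c0; have [p1 _] := Ppr 0%N isT; apply: p1.
  by rewrite -(rmorph1 emb) -(mulVf c0) rmorphM; exact: idealM.
have [P01 P1x P0x] := Px 0%N isT; have P0 := Ppr 0%N isT.
rewrite polyvalS => Psum.
suff H e : (e < D)%N -> forall l, l \in exps D n -> c (e :: l) = 0.
  move=> l /allpairsPdep[e [k [+ kn ->]]]; rewrite mem_iota => /H; exact.
elim/ltn_ind: e => e IHe eD.
pose v j := polyval D n (fun i => x i.+1) (fun l => c (j :: l)).
have v0 j : (j < e)%N -> v j = 0.
  move=> je; rewrite /v /polyval big_seq big1 // => l lE.
  by rewrite (IHe j je (ltn_trans je eD) l lE) rmorph0 mul0r.
apply: (IH (fun i => x i.+1) (fun i => P i.+1) (fun l => c (e :: l))).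
- by move=> i ni; exact: (Ppr i.+1).
- by move=> i ni; exact: (Px i.+1).
suff [r Er] : exists r, \sum_(0 <= j < D) x 0%N ^+ j * v j = x 0%N ^+ e * (v e + x 0%N * r).
  have /(prime_expM P0 P0x)/P01 : P 0%N (x 0%N ^+ e * (v e + x 0%N * r)) by rewrite -Er.
  move=> Pve; rewrite -[polyval _ _ _ _](addrK (x 0%N * r)).
  by apply: idealD => //; rewrite mulrC -mulNr; exact: idealM.
exists (\sum_(e.+1 <= j < D) x 0%N ^+ (j - e.+1) * v j).
rewrite (@big_cat_nat _ _ _ e) //=; last exact: ltnW.
rewrite big_nat big1 ?add0r => [|j /= je]; last by rewrite v0 ?mulr0.
rewrite big_ltn // mulrDr; congr (_ + _); rewrite !mulr_sumr !big_nat.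
apply: eq_bigr => j /andP[ej _]; rewrite !mulrA; congr (_ * _).
by rewrite -exprSr -exprD subnKC.
Qed.

Lemma krull_upper n :
  (forall x, exists D c l, [/\ l \in exps D n.+1, c l != 0 & polyval D n.+1 x c = 0]) ->
  forall m P, @prime_chain Q m P -> (m <= n)%N.
Proof.
move=> algdep m P [Ppr Psub]; rewrite leqNgt; apply/negP => nm.
have /choice[x xP] i : exists y, (i < n.+1)%N -> P i.+1 y /\ ~ P i y.
  have [lt|_] := ltnP i n.+1; last by exists 0.
  have [_ /existsNP[y /not_implyP[? ?]]] := Psub i (leq_trans lt nm).
  by exists y.
have [D [c [l [ln /eqP cl p0]]]] := algdep x; apply: cl.
apply: (@chain_algindep D n.+1 x P c) ln.
- by move=> i ni; apply: Ppr; exact: leq_trans nm.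
- move=> i ni; have [? ?] := xP i ni; split=> //.
  by have [] := Psub i (leq_trans ni nm).
- by rewrite p0; exact: ideal0.
Qed.

End KrullUpperBound.

Lemma left_kernel_vector (K : fieldType) p q (M : 'M[K]_(p, q)) : (q < p)%N ->
  exists2 v : 'rV_p, v != 0 & v *m M = 0.
Proof.
move=> qp; have : kermx M != 0.
  by rewrite -mxrank_eq0 mxrank_ker; have := rank_leq_col M; lia.
by move=> /rowV0Pn[v /sub_kermxP vM v0]; exists v.
Qed.

(** * Fiber rings of monomial filtrations *)

Section FiberRing.
Variables (K : fieldType) (d : nat) (CC : {set {set 'I_d}}) (g : nat).
Local Notation A := {mpoly K[d]}.
Variable F : filtration A.
Hypothesis FE : forall n f, F n f <-> forall m, m \in msupp f -> deg_ge CC (g * n) m.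

Lemma max_ideal_mulP n (f : A) : ideal_mul (max_ideal K d) (F n) f <->
  forall m, m \in msupp f -> exists2 i, (0 < m i)%N & deg_ge CC (g * n) (m - U_(i))%MM.
Proof.
pose Qn (m : 'X_{1..d}) := exists2 i : 'I_d, (0 < m i)%N & deg_ge CC (g * n) (m - U_(i))%MM.
have Qup u m : Qn m -> Qn (u + m)%MM.
  move=> [i mi md]; exists i; first by rewrite mnmDE; lia.
  by apply: deg_ge_up md; apply/mnm_lepP => j; rewrite !mnmBE mnmDE; lia.
split=> [|fm]; last first.
  apply: ideal_of_msupp => m /fm[i mi md].
  have -> : m = (U_(i) + (m - U_(i)))%MM by rewrite addmC submK // lep1mP -lt0n.
  rewrite mpolyXD; apply: ideal_mul_in; first by apply: ideal_genP; exists i.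
  by apply/FE => u; rewrite msuppX inE => /eqP ->.
suff : ideal_mul (max_ideal K d) (F n) `<=` mon_ideal K Qup by apply.
apply: (@ideal_gen_min _ _ (mon_ideal K Qup)) => _ [x mx] [y /FE Fy <-].
have up1 (u m : 'X_{1..d}) : (0 < mdeg m -> 0 < mdeg (u + m)%MM)%N by rewrite mdegD; lia.
have {mx} : mon_ideal K up1 x.
  suff : max_ideal K d `<=` mon_ideal K up1 by apply.
  apply: ideal_gen_min => _ [i _ <-].
  by apply/mon_idealX; rewrite mdeg1.
move=> mx m /msuppM_le /allpairsP[[u v] /= [/mx u0 /Fy vd ->]].
have [i ui] : exists i, (0 < u i)%N.
  move: u0; rewrite lt0n mdegE sum_nat_eq0 negb_forall => /existsP[i].
  by rewrite /= -lt0n; exists i.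
exists i; first by rewrite mnmDE; lia.
apply: deg_ge_up vd; apply/mnm_lepP => j; rewrite mnmBE mnmDE mnm1E.
by case: eqP => [<-|_]; lia.
Qed.

Lemma reesP (f : rees F) n m : m \in msupp (rees_val f)`_n -> deg_ge CC (g * n) m.
Proof. by case: f => f /= /asboolP /(_ n) /FE; apply. Qed.

(** The covering monomials of F n are those outside the product of the maximal ideal with F n, so
    they give a K-basis of the fiber ring. *)
Lemma fiber_predP (f : rees F) : reflect
  (forall n m, covers (tights CC (g * n) m) -> ((rees_val f)`_n)@_m = 0)
  (f \in fiber_pred (F := F)).
Proof.
apply: (iffP (asboolP _)) => [fm n m cov|fcov n].
  apply/eqP; rewrite mcoeff_eq0; apply/negP => mf.
  have [i mi md] := (max_ideal_mulP _ _).1 (fm n) m mf.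
  by have /(_ cov i mi) := (covers_minimal (reesP mf)).1; apply.
apply/max_ideal_mulP => m mf; apply: contrapT => nm.
move: (mf); rewrite mcoeff_msupp fcov ?eqxx //.
apply/(covers_minimal (reesP mf)) => i mi md.
by apply: nm; exists i.
Qed.

Local Notation Q := (fiber_ring F).

Definition fiber_pi : rees F -> Q := \pi_Q.

HB.instance Definition _ := GRing.RMorphism.on fiber_pi.

Lemma fiber_pi_eq0 f : (fiber_pi f == 0) = (f \in fiber_pred (F := F)).
Proof. by rewrite -(rmorph0 fiber_pi) /fiber_pi -Quotient.idealrBE subr0. Qed.

Lemma fiber_reprK x : fiber_pi (repr x) = x.
Proof. exact: reprK. Qed.

Lemma rees_const_subproof (c : K) : (c%:MP_[d])%:P \in rees_pred F.
Proof.
apply/asboolP => n; rewrite coefC; case: n => [|n]; last exact: ideal0.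
exact: fil0.
Qed.

Definition rees_const c : rees F := Rees (rees_const_subproof c).

Lemma rees_const_zmod : zmod_morphism rees_const.
Proof. by move=> a b; apply/val_inj; rewrite /= !rmorphB. Qed.

Lemma rees_const_monoid : monoid_morphism rees_const.
Proof.
split; first by apply/val_inj; rewrite /= !rmorph1.
by move=> a b; apply/val_inj; rewrite /= !rmorphM.
Qed.

HB.instance Definition _ := GRing.isZmodMorphism.Build K (rees F) rees_const rees_const_zmod.
HB.instance Definition _ := GRing.isMonoidMorphism.Build K (rees F) rees_const rees_const_monoid.

End FiberRing.

(** * Upper bound on the dimension of the fiber ring *)

Lemma polyval_map (K : fieldType) (Q Q' : comNzRingType) (emb : {rmorphism K -> Q})
    (h : {rmorphism Q -> Q'}) D n x c :
  h (polyval emb D n x c) = polyval (h \o emb) D n (h \o x) c.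
Proof.
rewrite /polyval rmorph_sum; apply: eq_bigr => l _; rewrite rmorphM; congr (_ * _).
by elim: l x => [|e l IH] x /=; rewrite ?rmorph1 // rmorphM rmorphXn /= IH.
Qed.

Lemma leq_exp2rW m n e : (m <= n)%N -> (m ^ e <= n ^ e)%N.
Proof. by move=> mn; case: e => // e; rewrite leq_exp2r. Qed.

Section FiberDimUpper.
Variables (K : fieldType) (d : nat) (CC : {set {set 'I_d}}) (g : nat).
Local Notation A := {mpoly K[d]}.
Variable F : filtration A.
Hypothesis FE : forall n f, F n f <-> forall m, m \in msupp f -> deg_ge CC (g * n) m.
Variable k : nat.
Hypothesis kd : (k <= d)%N.
Hypothesis dir_le : forall n m, deg_ge CC n m -> covers (tights CC n m) ->
  (dirdim rat (tights CC n m) <= k)%N.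

Lemma size_mon (f : nat -> rees F) D n s l :
  (forall i, (i < n)%N -> (size (rees_val (f i)) <= s.+1)%N) -> l \in exps D n ->
  (size (rees_val (mon f l)) <= (n * D * s).+1)%N.
Proof.
elim: n f l => [|n IH] f l fs /=; first by rewrite inE => /eqP -> /=; rewrite size_poly1.
move=> /allpairsPdep[e [l' [eD l'n ->]]] /=.
have := IH (fun i => f i.+1) l' (fun i => fs i.+1) l'n.
have := size_polyMleq (rees_val (f 0%N ^+ e)) (rees_val (mon (fun i => f i.+1) l')).
have : (size (rees_val (f 0%N ^+ e)) <= (D * s).+1)%N.
  rewrite -[rees_val _]/(val _) rmorphXn /=.
  apply: leq_trans (size_poly_exp_leq _ _) _; rewrite ltnS.
  have := fs 0%N isT; rewrite mem_iota in eD => fs0.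
  apply: leq_trans (_ : s * e <= _)%N; last first.
    by rewrite mulnC leq_mul //; case/andP: eD => _ /ltnW.
  by rewrite leq_mul // -ltnS; case: (size _) fs0.
move=> s1 s2 s3; apply: leq_trans s2 _; rewrite mulSn mulnDl.
by move: s1 s3; set a := size _; set b := size _; lia.
Qed.

(** A minimal generator of t-degree at most N is determined by its tight set, its t-degree and k
    exponents, each at most g N. Each such datum gives a linear functional, and together they detect
    nonzero classes in the fiber ring. *)
Lemma fiber_coordinates N : exists (J : finType) (psi : J -> rees F -> K),
  [/\ #|J| = (#|{set {set 'I_d}}| * N.+1 * (g * N).+1 ^ k)%N,
      forall j (T : Type) (r : seq T) (c : T -> K) (f : T -> rees F),
        psi j (\sum_(t <- r) rees_const F (c t) * f t) = \sum_(t <- r) c t * psi j (f t) &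
      forall f, (size (rees_val f) <= N.+1)%N -> (forall j, psi j f = 0) ->
        f \in fiber_pred (F := F)].
Proof.
have /choice[c cP] W : exists c : 'I_k -> 'I_d, (dirdim rat W <= k)%N ->
    forall n m m', deg_ge CC n m -> deg_ge CC n m' -> tights CC n m = W ->
      tights CC n m' = W -> (forall j, m (c j) = m' (c j)) -> m = m'.
  have [Wk|] := boolP (dirdim rat W <= k)%N; last by exists (widen_ord kd).
  by have [|c cP] := @tights_coords d CC k W; [rewrite Wk|exists c].
pose J : finType := ({set {set 'I_d}} * 'I_N.+1 * {ffun 'I_k -> 'I_(g * N).+1})%type.
pose pt (j : J) m := [/\ deg_ge CC (g * j.1.2) m, covers (tights CC (g * j.1.2) m),
  tights CC (g * j.1.2) m = j.1.1 & forall i, m (c j.1.1 i) = j.2 i].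
(* The coefficient of the monomial with data j, or 0 if there is none; [cP] makes this monomial
   unique. *)
pose psi (j : J) (f : rees F) : K :=
  if pselect (exists m, pt j m) is left h then ((rees_val f)`_j.1.2)@_(sval (cid h)) else 0.
exists J, psi; split.
- by rewrite !card_prod card_ord card_ffun !card_ord.
- move=> j T r a f; rewrite /psi; case: pselect => [h|_]; last first.
    by rewrite big1 // => t _; rewrite mulr0.
  rewrite -[rees_val _]/(val _) raddf_sum coef_sum raddf_sum; apply: eq_bigr => t _ /=.
  by rewrite coefCM mcoeffCM.
move=> f fN psi0; apply/(fiber_predP FE) => n m cov.
have [nN|nN] := ltnP n N.+1; last first.
  by rewrite nth_default ?mcoeff0 //; exact: leq_trans nN.
apply: contrapT => fm0; have mf : m \in msupp (rees_val f)`_n.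
  by rewrite mcoeff_msupp; apply/eqP.
have md := reesP FE mf.
pose j : J := (tights CC (g * n) m, Ordinal nN,
  [ffun i => inord (m (c (tights CC (g * n) m) i))]).
have mpt : pt j m.
  split=> // i; rewrite /= ffunE inordK // ltnS.
  apply: leq_trans (tights_le _ cov) _.
  by rewrite leq_mul2l -ltnS nN orbT.
have := psi0 j; rewrite /psi; case: pselect => [h|[]]; last by exists m.
case: cid => m' /= [m'd m'cov m'W m'c].
have <- // : m = m'.
apply: (cP (tights CC (g * n) m)) m'd _ m'W _ => //; first exact: dir_le.
by move=> i; have [_ _ _ /(_ i)] := mpt; rewrite m'c.
Qed.

Lemma fiber_krull_upper m P : @prime_chain (fiber_ring F) m P -> (m <= k.+1)%N.
Proof.
apply: (@krull_upper K _ (@fiber_pi _ _ F \o @rees_const _ _ F)) => x.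
pose f i : rees F := repr (x i).
pose s := \max_(i < k.+2) size (rees_val (f i)).
have fs i : (i < k.+2)%N -> (size (rees_val (f i)) <= s.+1)%N.
  by move=> ik; apply: leqW; exact: (leq_bigmax (Ordinal ik)).
(* Monomials in the [f i] with exponents below D have t-degree at most q D. There are D^(k+2) of
   them and at most (D - 1) D^(k+1) functionals, so they are linearly dependent in the fiber
   ring. *)
pose q := (k.+2 * s)%N; pose G := (g * q + q).+1.
pose D := (#|{set {set 'I_d}}| * G ^ k.+1).+1.
have [J [psi [cardJ psi_lin psi0]]] := fiber_coordinates (q * D).
have JD : (#|J| < size (exps D k.+2))%N.
  rewrite size_exps expnS {1}/D mulSn cardJ -mulnA.
  have GD : ((q * D).+1 * (g * (q * D)).+1 ^ k <= G ^ k.+1 * D ^ k.+1)%N.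
    have bound a b : (0 < b)%N -> (a <= g * q + q)%N -> ((a * b).+1 <= (g * q + q).+1 * b)%N.
      by move=> b0 aG; rewrite mulSn addnC -addn1 leq_add // leq_mul2r aG orbT.
    rewrite -expnMn expnS leq_mul //; first by apply: bound; rewrite ?leq_addl.
    by rewrite mulnA leq_exp2rW //; apply: bound; rewrite ?leq_addr.
  apply: leq_ltn_trans (leq_mul (leqnn _) GD) _.
  by rewrite mulnA -[ltnLHS]add0n ltn_add2r expn_gt0.
pose M : 'M[K]_(size (exps D k.+2), #|J|) :=
  \matrix_(i, j) psi (enum_val j) (mon f (nth [::] (exps D k.+2) i)).
have [v v0 vM] := left_kernel_vector M JD.
(* The coefficients come from the kernel vector, with value 0 outside [exps]. *)
pose c l := if insub (index l (exps D k.+2)) is Some i then v 0 i else 0.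
have cE (i : 'I_(size (exps D k.+2))) : c (nth [::] (exps D k.+2) i) = v 0 i.
  by rewrite /c index_uniq ?exps_uniq // valK.
have [i vi] : exists i, v 0 i != 0.
  by apply/rV0Pn.
exists D, c, (nth [::] (exps D k.+2) i); split; first exact: mem_nth.
  by rewrite cE.
have -> : polyval (@fiber_pi _ _ F \o @rees_const _ _ F) D k.+2 x c =
          fiber_pi (polyval (@rees_const _ _ F) D k.+2 f c).
  rewrite polyval_map; congr polyval; apply/funext => j /=.
  by rewrite fiber_reprK.
apply/eqP; rewrite fiber_pi_eq0; apply: psi0.
  rewrite -[rees_val _]/(val _) /polyval raddf_sum big_seq.
  elim/big_ind: _ => [|a b aq bq|l lE]; first by rewrite size_poly0.
    by apply: leq_trans (size_polyD _ _) _; rewrite geq_max aq bq.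
  rewrite /= mul_polyC; apply: leq_trans (size_scale_leq _ _) _.
  by apply: leq_trans (size_mon fs lE) _; rewrite /q ltnS mulnAC.
move=> j; rewrite /polyval psi_lin.
move/rowP: vM => /(_ (enum_rank j)); rewrite mxE [RHS]mxE => E; rewrite -[RHS]E.
rewrite (big_nth [::]) big_mkord; apply: eq_bigr => l _.
by rewrite mxE cE enum_rankK.
Qed.

End FiberDimUpper.

(** * The monoid of a face *)

Lemma clear_denominators (T : finType) (v : T -> rat) :
  exists2 D : nat, (0 < D)%N & exists z : T -> int, forall i, (z i)%:~R = D%:R * v i.
Proof.
pose den i : nat := `|denq (v i)|%N.
exists (\prod_i den i)%N; first by rewrite prodn_gt0 // => i; rewrite absz_gt0 denq_neq0.
exists (fun i => numq (v i) * (\prod_(j | j != i) den j)%N%:Z) => i.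
have -> : (\prod_j den j = den i * \prod_(j | j != i) den j)%N by rewrite (bigD1 i).
rewrite natrM rmorphM /= mulrAC -[in RHS](divq_num_den (v i)); congr (_ * _).
have -> : (den i)%:R = (denq (v i))%:~R :> rat by rewrite -[denq _]absz_denq.
by rewrite mulrC divfK // intr_eq0 denq_neq0.
Qed.

Section FaceMonoid.
Variables (d : nat) (CC : {set {set 'I_d}}) (n0 : nat) (m0 : 'X_{1..d}).
Hypothesis m0_deg : deg_ge CC n0 m0.
Local Notation W0 := (tights CC n0 m0).

(** For positive n and n0: m/n lies on the smallest face containing m0/n0. The homogeneous form
    makes these pairs a monoid. *)
Definition onface n m := deg_ge CC n m /\
  ((forall C, C \in CC -> csum C m0 = n0 -> csum C m = n) /\
   (forall i, m0 i = 0%N -> m i = 0%N)).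

(** The sum of the indicators of all constraints tight at m0. In degree n its value is at least n
    times [face_height], with equality exactly on the face; vanishing exponents add nothing to the
    height. *)
Definition face_wt (i : 'I_d) : nat :=
  (\sum_(C in CC | csum C m0 == n0) (i \in C) + (m0 i == 0))%N.

Definition face_height : nat := #|[set C in CC | csum C m0 == n0]%SET|.

Lemma wdeg_face_wt m : wdeg face_wt m =
  (\sum_(C in CC | csum C m0 == n0) csum C m + \sum_(i | m0 i == 0) m i)%N.
Proof.
rewrite /wdeg /face_wt.
rewrite (eq_bigr (fun i => (\sum_(C in CC | csum C m0 == n0) (i \in C) * m i +
  (m0 i == 0) * m i)%N)) => [|i _]; last by rewrite mulnDl big_distrl.
rewrite big_split /= exchange_big /=; congr (_ + _)%N.
  by apply: eq_bigr => C _; rewrite csum_wdeg.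
by rewrite [RHS]big_mkcond; apply: eq_bigr => i _; case: eqP; rewrite ?mul1n ?mul0n.
Qed.

Lemma wdeg_face n m : deg_ge CC n m -> wdeg face_wt m = (n * face_height +
  (\sum_(C in CC | csum C m0 == n0) (csum C m - n) + \sum_(i | m0 i == 0) m i))%N.
Proof.
move=> nm; rewrite wdeg_face_wt addnA; congr (_ + _)%N.
have -> : (n * face_height = \sum_(C in CC | csum C m0 == n0) n)%N.
  rewrite sum_nat_const mulnC; congr (_ * _)%N.
  by apply: eq_card => C; rewrite !inE.
rewrite -big_split /=; apply: eq_bigr => C /andP[CC_ _].
by rewrite subnKC // nm.
Qed.

Lemma wdeg_face_ge n m : deg_ge CC n m -> (n * face_height <= wdeg face_wt m)%N.
Proof. by move=> /wdeg_face ->; exact: leq_addr. Qed.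

Lemma onfaceP n m : deg_ge CC n m ->
  (wdeg face_wt m == n * face_height)%N <-> onface n m.
Proof.
move=> nm; rewrite (wdeg_face nm) -[X in _ == X]addn0 eqn_add2l addn_eq0 !sum_nat_eq0.
split=> [/andP[/forallP mT /forallP mZ]|[_ [mT mZ]]].
  split=> //; split=> [C CC_ C0|i i0].
    have := mT C; rewrite CC_ C0 eqxx subn_eq0 /= => Cn.
    by apply/eqP; rewrite eqn_leq Cn nm.
  by have := mZ i; rewrite i0 eqxx => /eqP.
apply/andP; split; apply/forallP => x; apply/implyP.
  by move=> /andP[CC_ /eqP C0]; rewrite mT // subnn.
by move=> /eqP/mZ ->.
Qed.

Lemma onface_covers n m : covers W0 -> onface n m -> covers (tights CC n m).
Proof.
move=> cov [nm [mT mZ]] i; have [C CW iC] := cov i; exists C => //; apply/tightsP.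
move/tightsP: CW => [[CC_ /mT->//]|[j -> /mZ]]; [by left|by right; exists j].
Qed.

(** A large multiple of m0 leaves room in all loose constraints for the integral vector z = D v,
    while the tight ones are preserved because v is in the kernel. *)
Lemma onface_translate g (v : 'rV[rat]_d) : (0 < g)%N -> v *m dirmx rat W0 = 0 ->
  exists n m1 m2 (q : rat), [/\ q != 0, onface (g * n) m1, onface (g * n) m2 &
    forall i, (m2 i)%:R = (m1 i)%:R + q * v 0 i].
Proof.
move=> g0 /dirmxP Wv; have [D D0 [z zE]] := clear_denominators (v 0).
(* B bounds the absolute value of the sum of z over any C, and N > B: at N m0 every loose constraint
   has slack at least N. The factor g makes the degree N n0 a multiple of g. *)
pose B := (\sum_i `|z i|)%N; pose N := (g * B.+1)%N.
have NB : (B < N)%N by rewrite /N; nia.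
have gN : (g * (B.+1 * n0) = N * n0)%N by rewrite mulnA.
clearbody N.
have zW C : C \in W0 -> \sum_(i in C) z i = 0.
  move=> /Wv Cv; apply/eqP; rewrite -(intr_eq0 rat) rmorph_sum /=.
  by rewrite (eq_bigr (fun i => D%:R * v 0 i)) // -mulr_sumr Cv mulr0.
have z0 i : m0 i = 0%N -> z i = 0.
  move=> mi; have := zW [set i]%SET; rewrite big_set1; apply.
  by apply/tightsP; right; exists i.
have zB (C : {set _}) : (- (B%:Z) <= \sum_(i in C) z i)%R.
  rewrite lerNl -sumrN.
  apply: le_trans (_ : \sum_(i in C) (`|z i|%N)%:Z <= _).
    by apply: ler_sum => i _; lia.
  rewrite -(big_morph Posz PoszD (erefl _)) lez_nat /B [leqRHS](bigID (mem C)) /=.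
  exact: leq_addr.
have m2_ge0 i : 0 <= (N * m0 i)%N%:Z + z i.
  have [mi|mi] := posnP (m0 i); first by rewrite z0 // mi muln0.
  have : (`|z i| <= B)%N by rewrite /B (bigD1 i) //= leq_addr.
  have : (N <= N * m0 i)%N by rewrite leq_pmulr.
  by move: NB; lia.
clearbody B; pose m2 := [multinom `|((N * m0 i)%N%:Z + z i)%R|%N | i < d].
have m2E i : (m2 i)%:Z = (N * m0 i)%N%:Z + z i by rewrite mnmE gez0_abs.
have m2C C : (csum C m2)%:Z = (N * csum C m0)%N%:Z + \sum_(i in C) z i.
  rewrite /csum (big_morph Posz PoszD (erefl _)) big_distrr /=.
  rewrite (big_morph Posz PoszD (erefl _)) -big_split /=.
  by apply: eq_bigr => i _.
exists (B.+1 * n0)%N, (m0 *+ N)%MM, m2, D%:R; rewrite gN; split.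
- by rewrite pnatr_eq0 -lt0n.
- split; first exact: deg_geMn.
  split=> [C CC_ C0|i mi]; last by rewrite mulmnE mi.
  rewrite /csum (eq_bigr (fun i => N * m0 i)%N) -?big_distrr /= ?C0 //.
    by rewrite -/(csum C m0) C0.
  by move=> i _; rewrite mulmnE mulnC.
- have tight C : C \in CC -> csum C m0 = n0 -> csum C m2 = (N * n0)%N.
    move=> CC_ C0; apply/eqP; rewrite -eqz_nat m2C zW ?addr0 ?C0 //.
    by apply/tightsP; left.
  split; last first.
    split=> // i mi; apply/eqP; rewrite -eqz_nat m2E mi muln0 z0 //.
  move=> C CC_; have := m0_deg CC_; rewrite leq_eqVlt => /orP[/eqP C0|C0].
    by rewrite tight.
  rewrite -lez_nat m2C; have := zB C; have : (N * n0.+1 <= N * csum C m0)%N.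
    by rewrite leq_mul2l C0 orbT.
  by rewrite mulnS; move: NB; set s := \sum_(i in C) _; clearbody s; clear; lia.
move=> i; have := congr1 (fun x : int => x%:~R : rat) (m2E i).
rewrite /= rmorphD /= zE => E; rewrite [LHS]E mulmnE mulnC //.
Qed.

End FaceMonoid.

(** * Lower bound on the dimension of the fiber ring *)

Section KernelPrime.
Variables (Q : comNzRingType) (B : idomainType) (h : {rmorphism Q -> B}).

Program Definition ker_ideal : ideal Q := @Ideal Q [set x | h x = 0] _ _ _.
Next Obligation. exact: rmorph0. Qed.
Next Obligation. by move=> x y /= hx hy; rewrite rmorphD hx hy addr0. Qed.
Next Obligation. by move=> a x /= hx; rewrite rmorphM hx mulr0. Qed.

Lemma ker_ideal_prime : is_prime ker_ideal.
Proof.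
split=> [/eqP|x y /eqP]; first by rewrite rmorph1 oner_eq0.
by rewrite rmorphM mulf_eq0 => /orP[] /eqP; [left|right].
Qed.

End KernelPrime.

(** Setting further variables to 1 is a ring homomorphism, namely the constant coefficient of
    [wsubst] with zero weights. *)
Lemma mrestr_sum_eq0 (K : fieldType) d (S S' : {set 'I_d}) (r : seq 'X_{1..d})
    (P : pred 'X_{1..d}) (c : 'X_{1..d} -> K) : S' \subset S ->
  \sum_(m <- r | P m) c m *: 'X_[mrestr S m] = 0 :> {mpoly K[d]} ->
  \sum_(m <- r | P m) c m *: 'X_[mrestr S' m] = 0 :> {mpoly K[d]}.
Proof.
move=> /fintype.subsetP S'S p0.
pose p : {mpoly K[d]} := \sum_(m <- r | P m) c m *: 'X_[mrestr S m].
suff <- : (wsubst (fun=> 0%N) S' p)`_0 = \sum_(m <- r | P m) c m *: 'X_[mrestr S' m].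
  by rewrite (_ : p = 0) // rmorph0 coef0.
rewrite rmorph_sum coef_sum; apply: eq_bigr => m _.
rewrite wsubst_coef; have [->|c0] := eqVneq (c m) 0.
  by rewrite !scale0r msupp0 big_nil.
rewrite msuppMCX // big_cons big_nil /wdeg big1 // eqxx addr0 mcoeffZ mcoeffX eqxx mulr1.
congr (_ *: 'X_[_]); apply/mnmP => i; rewrite !mnmE.
by case: (boolP (i \in S')) => // /S'S ->.
Qed.

Lemma wsubst_restr (K : fieldType) d (a : 'I_d -> nat) (S S' : {set 'I_d})
    (f : {mpoly K[d]}) n :
  S' \subset S -> (wsubst a S f)`_n = 0 -> (wsubst a S' f)`_n = 0.
Proof.
move=> S'S f0; apply: (etrans (wsubst_coef a S' f n)); apply: mrestr_sum_eq0 S'S _.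
exact: (etrans (esym (wsubst_coef a S f n)) f0).
Qed.

Lemma mpolyX_inj (K : fieldType) d (u v : 'X_{1..d}) :
  'X_[u] = 'X_[v] :> {mpoly K[d]} -> u = v.
Proof. by move=> /(congr1 (fun f : {mpoly K[d]} => msupp f)); rewrite !msuppX => -[]. Qed.

Lemma mpolyX_neq0 (K : fieldType) d (u : 'X_{1..d}) : 'X_[u] <> 0 :> {mpoly K[d]}.
Proof. by move=> /(congr1 (fun f : {mpoly K[d]} => msupp f)); rewrite msuppX msupp0. Qed.

Lemma polyC_mulXn_inj (R : nzRingType) (a b : R) n :
  a%:P * 'X^n = b%:P * 'X^n -> a = b.
Proof. by move=> /polyP/(_ n); rewrite !coefCM coefXn eqxx !mulr1. Qed.

Section FiberDimLower.
Variables (K : fieldType) (d : nat) (CC : {set {set 'I_d}}) (g : nat).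
Local Notation A := {mpoly K[d]}.
Variable F : filtration A.
Hypothesis FE : forall n f, F n f <-> forall m, m \in msupp f -> deg_ge CC (g * n) m.
Hypothesis g_gt0 : (0 < g)%N.
Variables (n0 : nat) (m0 : 'X_{1..d}).
Hypotheses (n0_gt0 : (0 < n0)%N) (m0_deg : deg_ge CC n0 m0).
Hypothesis m0_cov : covers (tights CC n0 m0).
Implicit Types (S : {set 'I_d}) (f : rees F).

Local Notation Q := (fiber_ring F).
Local Notation h := (face_height CC n0 m0).
Local Notation wt := (face_wt CC n0 m0).

(* The projection of the fiber ring onto the monoid algebra of the face of m0,
   followed by x_i := 1 for i outside S. *)
Definition face_proj S f : {poly A} :=
  \poly_(n < size (rees_val f)) (wsubst wt S (rees_val f)`_n)`_(g * n * h).

Lemma face_proj_coef S f n :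
  (face_proj S f)`_n = (wsubst wt S (rees_val f)`_n)`_(g * n * h).
Proof.
rewrite coef_poly; case: ltnP => // fn.
by rewrite [(rees_val f)`_n]nth_default // rmorph0 coef0.
Qed.

Lemma face_projB S f f' : face_proj S (f - f') = face_proj S f - face_proj S f'.
Proof.
apply/polyP => n; rewrite coefB !face_proj_coef.
have -> : (rees_val (f - f'))`_n = (rees_val f)`_n - (rees_val f')`_n.
  by rewrite -[rees_val (f - f')]/(rees_val f - rees_val f') coefB.
by rewrite (@wsubst_zmod_morphism K d wt S) coefB.
Qed.

Lemma face_proj1 S : face_proj S 1 = 1.
Proof.
apply/polyP => n; rewrite face_proj_coef -[rees_val 1]/(1 : {poly A}) !coef1.
case: n => [|n] /=; last by rewrite rmorph0 coef0.
by rewrite rmorph1 muln0 mul0n coef1.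
Qed.

Lemma face_proj_low S f n k : (k < g * n * h)%N -> (wsubst wt S (rees_val f)`_n)`_k = 0.
Proof.
apply: wsubst_low => m /(reesP FE) md.
exact: wdeg_face_ge.
Qed.

(** g n h is a lower bound for the order in t-degree n, it is additive in n, and lowest coefficients
    multiply. *)
Lemma face_projM S f f' : face_proj S (f * f') = face_proj S f * face_proj S f'.
Proof.
apply/polyP => n; rewrite coefM face_proj_coef /= coefM rmorph_sum coef_sum.
apply: eq_bigr => i _; rewrite !face_proj_coef rmorphM.
have -> : (g * n * h = g * i * h + g * (n - i) * h)%N.
  by rewrite -mulnDl -mulnDr subnKC // -ltnS.
by apply: low_coefM => k; exact: face_proj_low.
Qed.

(** A monomial contributing to the projection has minimal weight, so it lies on the face and is
    covering; elements of the fiber ideal have coefficient 0 there. *)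
Lemma face_proj_fiber S f : f \in fiber_pred (F := F) -> face_proj S f = 0.
Proof.
move=> /(fiber_predP FE) f0; apply/polyP => n; rewrite face_proj_coef coef0.
rewrite wsubst_coef big_seq_cond big1 // => m /andP[mf mw].
rewrite f0 ?scale0r //; apply: (onface_covers m0_cov).
exact/(onfaceP n0 m0 (reesP FE mf)).
Qed.

Definition fiber_face_proj S (x : Q) : {poly A} := face_proj S (repr x).

Lemma fiber_face_projE S f : fiber_face_proj S (fiber_pi f) = face_proj S f.
Proof.
apply/eqP; rewrite -subr_eq0 -face_projB face_proj_fiber //.
by rewrite -(fiber_pi_eq0 (F := F)) (rmorphB (@fiber_pi _ _ F)) /= fiber_reprK subrr.
Qed.

Lemma fiber_face_proj_zmod S : zmod_morphism (fiber_face_proj S).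
Proof.
by move=> x y; rewrite -[x]fiber_reprK -[y]fiber_reprK -(rmorphB (@fiber_pi _ _ F)) !fiber_face_projE face_projB.
Qed.

Lemma fiber_face_proj_monoid S : monoid_morphism (fiber_face_proj S).
Proof.
split; first by rewrite -(rmorph1 (@fiber_pi _ _ F)) fiber_face_projE face_proj1.
by move=> x y; rewrite -[x]fiber_reprK -[y]fiber_reprK -(rmorphM (@fiber_pi _ _ F)) !fiber_face_projE face_projM.
Qed.

HB.instance Definition _ S := GRing.isZmodMorphism.Build Q {poly A} (fiber_face_proj S)
  (fiber_face_proj_zmod S).
HB.instance Definition _ S := GRing.isMonoidMorphism.Build Q {poly A} (fiber_face_proj S)
  (fiber_face_proj_monoid S).

Lemma fiber_face_proj_restr S S' x : S' \subset S ->
  fiber_face_proj S x = 0 -> fiber_face_proj S' x = 0.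
Proof.
move=> S'S /polyP x0; apply/polyP => n; rewrite coef0 face_proj_coef.
apply: (wsubst_restr S'S).
by rewrite -face_proj_coef -/(fiber_face_proj S x) x0 coef0.
Qed.

(** One x serves every S, since its images under different projections are to be compared. *)
Lemma rees_mon_ex n m : onface CC n0 m0 (g * n) m -> exists x : Q, forall S,
  fiber_face_proj S x = ('X_[mrestr S m])%:P * 'X^n.
Proof.
move=> mF; have [md _] := mF.
have mR : ('X_[m])%:P * 'X^n \in rees_pred F.
  apply/asboolP => k; rewrite coefCM coefXn; case: eqP => [->|_]; last first.
    by rewrite mulr0; exact: ideal0.
  by rewrite mulr1; apply/FE => u; rewrite msuppX inE => /eqP ->.
have coefXX (u : 'X_{1..d}) k : (('X_[u])%:P * 'X^n : {poly A})`_k = 'X_[u] * (k == n)%:R.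
  by rewrite coefCM coefXn.
have coefR k : (rees_val (Rees mR))`_k = 'X_[m] * (k == n)%:R by exact: coefXX.
exists (fiber_pi (Rees mR)) => S; rewrite fiber_face_projE; apply/polyP => k.
apply: (etrans (face_proj_coef S (Rees mR) k)).
apply: (etrans (congr1 (fun p => (wsubst wt S p)`_(g * k * h)) (coefR k))).
apply: (etrans _ (esym (coefXX _ k))).
case: eqP => [->|_]; last by rewrite !mulr0 rmorph0 coef0.
rewrite !mulr1; apply: (etrans (wsubst_coef _ _ _ _)).
by rewrite msuppX big_cons big_nil (onfaceP n0 m0 md).2 // addr0 mcoeffX eqxx scale1r.
Qed.

(* S t consists of the first t of k coordinates that are independent on the face.
   For v dual to the last one, m2 - m1 = q v makes x^m2 - x^m1 vanish once that
   coordinate is set to 1. *)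
Lemma fiber_krull_lower :
  exists P, @prime_chain Q (dirdim rat (tights CC n0 m0)).+1 P.
Proof.
rewrite /dirdim; have [c [_ cdual]] := kernel_coords (dirmx rat (tights CC n0 m0)).
set k := (d - _)%N in c cdual *.
pose S t : {set 'I_d} := [set c j | j : 'I_k in [pred j : 'I_k | (j < t)%N]]%SET.
pose ev0 := (horner_eval (0 : A) \o fiber_face_proj finset.set0)%FUN.
(* The kernels grow as [S (k - i)] loses coordinates, and the last prime is the kernel after t := 0.
   This gives k + 1 strict steps. *)
pose P i := if (i <= k)%N then ker_ideal (fiber_face_proj (S (k - i)%N)) else ker_ideal ev0.
exists P; split=> [i _|i]; first by rewrite /P; case: ifP => _; exact: ker_ideal_prime.
rewrite ltnS /P => ik; rewrite ik; have [lt|ge] := ltnP i k.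
  split=> [x /=|].
    apply: fiber_face_proj_restr; apply: imsetS; apply/fintype.subsetP => j.
    by rewrite !inE; lia.
  have jk : (k - i.+1 < k)%N by lia.
  pose j0 := Ordinal jk.
  have [v vW vc] := cdual (fun j => (j == j0)%:R).
  have [n [m1 [m2 [q [q0 m1F m2F m2E]]]]] := onface_translate m0_deg g_gt0 vW.
  have [x1 x1E] := rees_mon_ex m1F; have [x2 x2E] := rees_mon_ex m2F.
  move=> /(_ (x2 - x1)) /=; rewrite !rmorphB /= !x1E !x2E.
  have -> : mrestr (S (k - i.+1)%N) m2 = mrestr (S (k - i.+1)%N) m1.
    apply/mnmP => l; rewrite !mnmE; case: ifP => // /imsetP[j].
    rewrite inE => jj0 ->; have := m2E (c j); rewrite vc.
    have -> : (j == j0) = false by apply/eqP => jE; rewrite jE /= ltnn in jj0.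
    by rewrite mulr0 addr0 => /eqP; rewrite eqr_nat => /eqP.
  move=> /(_ (subrr _))/subr0_eq/polyC_mulXn_inj/mpolyX_inj E.
  have : mrestr (S (k - i)%N) m1 (c j0) = mrestr (S (k - i)%N) m2 (c j0) by rewrite E.
  rewrite !mnmE; have -> : c j0 \in S (k - i)%N by apply: imset_f; rewrite inE /=; lia.
  have := m2E (c j0); rewrite vc eqxx mulr1 => + E'; rewrite E' => /eqP.
  by rewrite addrC -subr_eq subrr eq_sym (negPf q0).
have -> : (k - i = 0)%N by lia.
have -> : S 0%N = finset.set0.
  by apply/setP => l; rewrite inE; apply/imsetP => -[j]; rewrite inE.
split=> [x /= x0|/=]; first by rewrite /ev0 /= x0 rmorph0.
(* x maps to a monomial times t^n0 with n0 > 0: nonzero, but zero at t = 0. *)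
have [x xE] : exists x : Q, forall S,
    fiber_face_proj S x = ('X_[mrestr S (m0 *+ g)%MM])%:P * 'X^n0.
  apply: rees_mon_ex; split; first exact: deg_geMn.
  split=> [C CC_ C0|l ml]; last by rewrite mulmnE ml.
  by rewrite -[in RHS]C0 /csum big_distrr; apply: eq_bigr => l _; rewrite mulmnE mulnC.
move=> /(_ x) /=; rewrite /ev0 /= /horner_eval !xE hornerM hornerXn expr0n.
rewrite (gtn_eqF n0_gt0) mulr0 => /(_ erefl) x0.
by apply/(@mpolyX_neq0 K d)/(@polyC_mulXn_inj _ _ 0 n0); rewrite polyC0 mul0r; exact: x0.
Qed.

End FiberDimLower.

(** * Faces of the symbolic polyhedron *)

Lemma finite_pos_lower_bound (R : realFieldType) (T : finType) (f : T -> R) :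
  (forall t, 0 < f t) -> exists2 e, 0 < e & forall t, e <= f t.
Proof.
move=> f0; suff [e e0 eP] : exists2 e, 0 < e & forall t, t \in enum T -> e <= f t.
  by exists e => // t; apply: eP; rewrite mem_enum.
elim: (enum T) => [|t s [e e0 eP]]; first by exists 1.
exists (Num.min e (f t)) => [|u]; first by rewrite lt_min e0 f0.
by rewrite inE ge_min => /orP[/eqP ->|/eP ->]; rewrite ?lexx ?orbT.
Qed.

(** Solvability of a rational system descends from the reals to the rationals. Real solutions differ
    from a rational one by a combination of rational kernel vectors, whose coefficients can be
    approximated by rationals. *)
Lemma rational_solutions_dense (R : realType) d p (B : 'M[rat]_(d, p)) (b : 'rV[rat]_p)
    (y : 'rV[R]_d) :
  y *m map_mx ratr B = map_mx ratr b -> forall e, 0 < e ->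
  exists2 y' : 'rV[rat]_d, y' *m B = b & forall i, `|ratr (y' 0 i) - y 0 i| < e.
Proof.
move=> yB e e0.
have /submxP[y0 y0B] : (b <= B)%MS.
  by rewrite -(map_submx (ratr : rat -> R)) -yB submxMl.
have /submxP[u yu] : (y - map_mx ratr y0 <= map_mx (ratr : rat -> R) (kermx B))%MS.
  rewrite map_kermx; apply/sub_kermxP.
  by rewrite mulmxBl yB -map_mxM -y0B subrr.
set N := kermx B in yu.
have [t t0 tP] : exists2 t : R, 0 < t & forall i, t * \sum_l `|ratr (N l i) : R| < e.
  have [|t t0 tP] := @finite_pos_lower_bound R 'I_d
      (fun i => e / (1 + \sum_l `|ratr (N l i) : R|)).
    by move=> i; rewrite divr_gt0 // ltr_pwDl // sumr_ge0.
  exists t => // i; have := tP i.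
  have s0 : 0 <= \sum_l `|ratr (N l i) : R| by rewrite sumr_ge0.
  rewrite ler_pdivlMr; last by rewrite ltr_pwDl.
  by rewrite mulrDr mulr1; apply: lt_le_trans; rewrite ltrDr.
have /choice[u' u'P] l : exists q : rat, `|ratr q - u 0 l| < t.
  have [|q] := @rat_in_itvoo R (u 0 l - t) (u 0 l + t).
    by rewrite ltrD2l; lra.
  by rewrite in_itv /= => /andP[q1 q2]; exists q; rewrite ltr_norml; apply/andP; split; lra.
exists (y0 + (\row_l u' l) *m N) => [|i].
  by rewrite mulmxDl -y0B -mulmxA mulmx_ker mulmx0 addr0.
have -> : y = map_mx ratr y0 + u *m map_mx ratr N by rewrite -yu addrC subrK.
rewrite !mxE rmorphD /= opprD addrACA subrr add0r rmorph_sum /= -sumrB.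
apply: le_lt_trans (ler_norm_sum _ _ _) _; apply: le_lt_trans (tP i); rewrite mulr_sumr.
apply: ler_sum => l _; rewrite !mxE rmorphM /= -mulrBl normrM.
by apply: ler_wpM2r => //; exact: ltW.
Qed.

Section KernelSpace.
Variables (F : fieldType) (d p : nat) (B : 'M[F]_(d, p)).

Lemma kernel_vspace_dim : exists V : {vspace 'rV[F]_d},
  [/\ forall v, v \in V <-> v *m B = 0, \dim V = (d - \rank B)%N &
      forall U : {vspace 'rV[F]_d}, (U <= V)%VS -> (\dim U <= d - \rank B)%N].
Proof.
have [c [cinj cdual]] := kernel_coords B; set k := (d - _)%N in c cinj cdual *.
pose V := lker (linfun (mulmxr B) : 'Hom('rV[F]_d, 'rV[F]_p)).
have VP v : v \in V <-> v *m B = 0.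
  by rewrite memv_ker lfunE; split=> /eqP.
pose f : 'Hom('rV[F]_d, 'rV[F]_k) := linfun (colsub c).
have fE v j : f v 0 j = v 0 (c j) by rewrite lfunE mxE.
have dimU (U : {vspace 'rV[F]_d}) : (U <= V)%VS -> \dim (f @: U) = \dim U.
  move=> UV; apply: limg_dim_eq; apply/eqP; rewrite -subv0; apply/subvP => v.
  rewrite memv_cap => /andP[/(subvP UV)/VP vB]; rewrite memv_ker => /eqP fv.
  rewrite memv0; apply/eqP; apply: cinj => // j.
  by rewrite -fE fv mxE.
have dimfull : \dim {:'rV[F]_k} = k by rewrite dimvf dim_matrix mul1r.
exists V; split=> // [|U UV]; last first.
  by rewrite -(dimU U UV) -[leqRHS]dimfull dimvS // subvf.
rewrite -(dimU V) // -[RHS]dimfull; congr (\dim _); apply/eqP.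
rewrite eqEsubv subvf /=; apply/subvP => w _.
have [v vB vc] := cdual (w 0); have -> : w = f v.
  by apply/rowP => j; rewrite fE vc.
by apply: memv_img; apply/VP.
Qed.

End KernelSpace.

Section SymbolicPolyhedronFaces.
Variables (R : realType) (d : nat) (CC : {set {set 'I_d}}).
Implicit Types (x y u v : 'rV[R]_d) (C : {set 'I_d}).

Definition rsum C x : R := \sum_(i in C) x 0 i.

Definition cover_polyhedron : set 'rV[R]_d :=
  [set x : 'rV[R]_d | (forall i, 0 <= x 0 i) /\ forall C, C \in CC -> 1 <= rsum C x].

Definition rtights x : {set {set 'I_d}} :=
  ([set C in CC | rsum C x == 1] :|: [set [set i] | i in [set i | x 0 i == 0]])%SET.

Lemma rtightsP x C : reflect
  ((C \in CC /\ rsum C x = 1) \/ exists2 i, C = [set i]%SET & x 0 i = 0) (C \in rtights x).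
Proof.
rewrite !inE; apply: (iffP orP) => -[].
- by move=> /andP[? /eqP]; left.
- by move=> /imsetP[i]; rewrite inE => /eqP; right; exists i.
- by move=> [-> ->]; rewrite eqxx; left.
- by move=> [i -> xi]; right; apply: imset_f; rewrite inE xi.
Qed.

Lemma rsum1 i x : rsum [set i]%SET x = x 0 i.
Proof. by rewrite /rsum big_set1. Qed.

Lemma rsumD C x y : rsum C (x + y) = rsum C x + rsum C y.
Proof. by rewrite -big_split; apply: eq_bigr => i _; rewrite mxE. Qed.

Lemma rsumZ C a x : rsum C (a *: x) = a * rsum C x.
Proof. by rewrite mulr_sumr; apply: eq_bigr => i _; rewrite mxE. Qed.

Lemma rsumB C x y : rsum C (x - y) = rsum C x - rsum C y.
Proof. by rewrite rsumD -scaleN1r rsumZ mulN1r. Qed.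

Lemma rsum_sum C (I : finType) (t : I -> R) (x : I -> 'rV[R]_d) :
  rsum C (\sum_i t i *: x i) = \sum_i t i * rsum C (x i).
Proof.
rewrite (big_morph (rsum C) (rsumD C) (id1 := 0)); last first.
  by rewrite /rsum big1 // => i _; rewrite mxE.
by apply: eq_bigr => i _; rewrite rsumZ.
Qed.

Lemma rsum_ge C i x : (forall i, 0 <= x 0 i) -> i \in C -> x 0 i <= rsum C x.
Proof. by move=> x0 iC; rewrite /rsum (bigD1 i) //= lerDl sumr_ge0. Qed.

Lemma rsum_rtights x y C : cover_polyhedron x -> cover_polyhedron y ->
  C \in rtights y -> rsum C y <= rsum C x.
Proof.
move=> [x0 xC] _ /rtightsP[[CC_ ->]|[i -> yi]]; first exact: xC.
by rewrite !rsum1 yi.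
Qed.

Lemma rsum_le1 y C : cover_polyhedron y -> C \in rtights y -> rsum C y <= 1.
Proof. by move=> yP /rtightsP[[_ ->]|[j -> yj]]; rewrite ?rsum1 ?yj ?lexx ?ler01. Qed.

Lemma tights_rtights n m x :
  (forall C, C \in CC -> (csum C m == n) = (rsum C x == 1)) ->
  (forall i, (m i == 0%N) = (x 0 i == 0)) -> tights CC n m = rtights x.
Proof.
move=> mC m0; rewrite /tights /rtights.
have -> : [set C in CC | csum C m == n]%SET = [set C in CC | rsum C x == 1]%SET.
  by apply/setP => C; rewrite !inE; case: (boolP (C \in CC)) => //= /mC.
by have -> : [set i | m i == 0%N]%SET = [set i | x 0 i == 0]%SET by apply/setP => i; rewrite !inE.
Qed.

Lemma tights_ofnat n m : (0 < n)%N -> tights CC n m = rtights (n%:R^-1 *: mrow R m).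
Proof.
move=> n0; have nR : n%:R != 0 :> R by rewrite pnatr_eq0 -lt0n.
apply: tights_rtights => [C _|i]; last first.
  by rewrite !mxE mulf_eq0 invr_eq0 (negPf nR) /= pnatr_eq0.
by rewrite rsumZ /rsum mrow_sum -(inj_eq (mulfI nR)) mulrA mulfV // mul1r mulr1 eqr_nat.
Qed.

Lemma cover_polyhedron_ofnat n m : (0 < n)%N -> deg_ge CC n m ->
  cover_polyhedron (n%:R^-1 *: mrow R m).
Proof.
move=> n0 nm; split=> [i|C /nm Cn]; first by rewrite !mxE mulr_ge0 ?invr_ge0.
by rewrite rsumZ /rsum mrow_sum mulrC ler_pdivlMr ?ltr0n // mul1r ler_nat.
Qed.

(** The tight constraints form a rational linear system. A rational solution close to y keeps the
    others loose, and clearing denominators gives m and n. *)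
Lemma cover_polyhedron_rational y : cover_polyhedron y ->
  exists n m, [/\ (0 < n)%N, deg_ge CC n m & tights CC n m = rtights y].
Proof.
move=> [y0 yC]; set W := rtights y.
(* Moving each coordinate by less than e keeps positive coordinates positive and, as C has at most d
   elements, loose sums above 1. *)
have [e e0 eP] : exists2 e : R, 0 < e & (forall i, y 0 i != 0 -> e <= y 0 i) /\
    forall C, C \in CC -> rsum C y != 1 -> d%:R * e < rsum C y - 1.
  have [|e1 e10 e1P] := @finite_pos_lower_bound R 'I_d
      (fun i => if y 0 i == 0 then 1 else y 0 i).
    by move=> i; case: eqP => // /eqP yi; rewrite lt_neqAle eq_sym yi y0.
  have [|e2 e20 e2P] := @finite_pos_lower_bound R {set 'I_d}
      (fun C => if 1 < rsum C y then (rsum C y - 1) / d.+1%:R else 1).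
    by move=> C; case: ifP => // C1; rewrite divr_gt0 // subr_gt0.
  exists (Num.min e1 e2); first by rewrite lt_min e10.
  split=> [i yi|C /yC C1 Cn].
    by have := e1P i; rewrite (negPf yi); apply: le_trans; rewrite ge_min lexx.
  have := e2P C; rewrite lt_neqAle eq_sym Cn C1 /= ler_pdivlMr ?ltr0n // => e2C.
  apply: lt_le_trans e2C; rewrite mulrC; apply: (@le_lt_trans _ _ (e2 * d%:R)).
    by apply: ler_wpM2r => //; rewrite ge_min lexx orbT.
  by rewrite ltr_pM2l // ltr_nat.
pose b : 'rV[rat]_#|{set 'I_d}| :=
  \row_j ((enum_val j \in W) && (enum_val j \in CC) && (rsum (enum_val j) y == 1))%:R.
have yB : y *m map_mx ratr (dirmx rat W) = map_mx ratr b.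
  apply/rowP => j; rewrite mxE.
  under eq_bigr do rewrite !mxE rmorph_nat.
  rewrite !mxE rmorph_nat; case: (boolP (enum_val j \in W)) => /= jW; last first.
    by rewrite big1 // => i _; rewrite mulr0.
  have -> : \sum_i y 0 i * (i \in enum_val j)%:R = rsum (enum_val j) y.
    rewrite /rsum [RHS]big_mkcond; apply: eq_bigr => i _.
    by case: (_ \in _); rewrite ?mulr1 ?mulr0.
  move/rtightsP: jW => [[-> ->]|[i jE yi]]; first by rewrite eqxx.
  by rewrite jE rsum1 yi eq_sym oner_eq0 andbF.
have [y' y'B y'y] := rational_solutions_dense yB e0.
have y'W C : C \in W -> \sum_(i in C) y' 0 i = ((C \in CC) && (rsum C y == 1))%:R.
  move=> CW; have := congr1 (fun M : 'rV[rat]_ _ => M 0 (enum_rank C)) y'B.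
  rewrite !mxE enum_rankK CW /= => <-; rewrite [LHS]big_mkcond; apply: eq_bigr => i _.
  by rewrite mxE enum_rankK CW /=; case: (_ \in _); rewrite ?mulr1 ?mulr0.
have y'0 i : y 0 i = 0 -> y' 0 i = 0.
  move=> yi; have := y'W [set i]%SET; rewrite big_set1 rsum1 yi eq_sym oner_eq0 andbF.
  by apply; apply/rtightsP; right; exists i.
have y'pos i : y 0 i != 0 -> 0 < y' 0 i.
  move=> yi; have := y'y i; have := eP.1 i yi.
  by rewrite -(ltr0q R) ltr_norml => ? /andP[? _]; lra.
have y'ge0 i : 0 <= y' 0 i.
  by case: (eqVneq (y 0 i) 0) => [/y'0 ->//|/y'pos/ltW].
have y'tight C : C \in CC -> rsum C y = 1 -> \sum_(i in C) y' 0 i = 1.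
  by move=> CC_ C1; rewrite y'W ?CC_ ?C1 ?eqxx //; apply/rtightsP; left.
have y'loose C : C \in CC -> rsum C y != 1 -> 1 < \sum_(i in C) y' 0 i.
  move=> CC_ Cn; have Ce := eP.2 C CC_ Cn.
  have yy' : rsum C y - d%:R * e <= \sum_(i in C) ratr (y' 0 i).
    rewrite lerBlDr -lerBlDl -sumrB; apply: (@le_trans _ _ (\sum_(i in C) e)).
      apply: ler_sum => i _; have := y'y i.
      by rewrite ltr_norml => /andP[? ?]; lra.
    rewrite sumr_const -[leLHS]mulr_natl ler_wpM2r ?ler_nat ?(ltW e0) //.
    by rewrite -[leqRHS]card_ord max_card.
  by rewrite -(ltr_rat R) rmorph1 rmorph_sum /=; lra.
have [D D0 [z zE]] := clear_denominators (y' 0).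
pose m := [multinom `|z i|%N | i < d].
have mE i : (m i)%:R = D%:R * y' 0 i.
  rewrite -zE mnmE; have : 0 <= z i by rewrite -(ler0z rat) zE mulr_ge0.
  by case: (z i).
have mC C : (csum C m)%:R = D%:R * \sum_(i in C) y' 0 i.
  by rewrite natr_sum mulr_sumr; apply: eq_bigr.
have DR : (0 : rat) < D%:R by rewrite ltr0n.
exists D, m; split=> // [C CC_|].
  rewrite -(ler_nat rat) mC ler_peMr ?ler0n //.
  by case: (eqVneq (rsum C y) 1) => [/(y'tight _ CC_) ->//|/(y'loose _ CC_)/ltW].
apply: tights_rtights => [x xC|x].
  rewrite -(eqr_nat rat) mC -{2}[D%:R]mulr1 (inj_eq (mulfI (lt0r_neq0 DR))).
  by case: (eqVneq (rsum x y) 1) => [/(y'tight _ xC) ->|/(y'loose _ xC) /gt_eqF ->].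
rewrite -(eqr_nat rat) mE mulf_eq0 (gt_eqF DR) /=.
by case: (eqVneq (y 0 x) 0) => [/y'0 ->|/y'pos /gt_eqF ->].
Qed.

Definition tight_face y : set 'rV[R]_d :=
  [set x : 'rV[R]_d | cover_polyhedron x /\ forall C, C \in rtights y -> rsum C x = rsum C y].

(** Each tight constraint is minimal at y over the polyhedron, so their sum is minimal exactly where
    all of them are. *)
Lemma tight_face_face y : cover_polyhedron y -> face cover_polyhedron (tight_face y).
Proof.
move=> yP; split; first by exists y.
pose u : 'rV[R]_d := \row_i \sum_(C in rtights y) (i \in C)%:R.
have uE x : \sum_i u 0 i * x 0 i = \sum_(C in rtights y) rsum C x.
  rewrite (eq_bigr (fun i => \sum_(C in rtights y) (i \in C)%:R * x 0 i)); last first.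
    by move=> i _; rewrite mxE mulr_suml.
  rewrite exchange_big /=; apply: eq_bigr => C _.
  rewrite /rsum [RHS]big_mkcond; apply: eq_bigr => i _.
  by case: (_ \in _); rewrite ?mul1r ?mul0r.
exists u, (\sum_(C in rtights y) rsum C y); split=> [x xP|].
  by rewrite uE; apply: ler_sum => C; exact: rsum_rtights.
apply/seteqP; split=> x [xP] /=; rewrite ?uE => xy; split=> //=; rewrite ?uE.
  exact: eq_bigr.
move=> C CW; apply/eqP; rewrite eq_le; apply/andP; split; last exact: rsum_rtights.
rewrite leNgt; apply/negP => lt.
have : \sum_(C in rtights y) rsum C y < \sum_(C in rtights y) rsum C x.
  rewrite (bigD1 C) //= [ltRHS](bigD1 C) //=; apply: ltr_leD => //.
  by apply: ler_sum => D /andP[DW _]; exact: rsum_rtights.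
by rewrite xy ltxx.
Qed.

(** Each coordinate lies in a tight constraint, whose value is at most 1, so the face is contained
    in the unit cube. *)
Lemma tight_face_compact y : cover_polyhedron y -> covers (rtights y) ->
  compact (tight_face y).
Proof.
move=> yP ycov; apply: bounded_closed_compact.
  exists 1; split=> // M M1 x [[x0 xC] xW] /=; rewrite [leLHS]/Num.norm /= mx_normrE.
  apply/bigmax_leP; split=> [|[i j] _ /=]; first by rewrite (le_trans ler01) // ltW.
  rewrite ord1 ger0_norm //; apply: le_trans (ltW M1).
  have [C CW jC] := ycov j; apply: le_trans (rsum_ge x0 jC) _.
  by rewrite xW // (rsum_le1 yP CW).
have rsum_cont C : continuous (rsum C).
  apply: continuous_big => [|i _]; first exact: add_continuous.
  exact: coord_continuous.
have -> : tight_face y =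
    \bigcap_i [set x : 'rV[R]_d | 0 <= x 0 i] `&`
    \bigcap_(C in [set C | C \in CC]) (rsum C @^-1` [set t | 1 <= t]) `&`
    \bigcap_(C in [set C | C \in rtights y]) (rsum C @^-1` [set t | t = rsum C y]).
  apply/seteqP; split=> [x [[x0 xC] xW]|x [[x0 xC] xW]].
    by split; [split=> // i _; exact: x0|].
  by split; [split=> // i; exact: x0|].
apply: closedI; first apply: closedI.
- apply: closed_bigI => i _.
  apply: (@preimage_closed _ _ (fun x : 'rV[R]_d => x 0 i) [set t | 0 <= t]) => [x _|].
    exact: coord_continuous.
  exact: closed_ge.
- by apply: closed_bigI => C _; apply: preimage_closed => [x _|]; [exact: rsum_cont|exact: closed_ge].
- by apply: closed_bigI => C _; apply: preimage_closed => [x _|]; [exact: rsum_cont|exact: closed_eq].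
Qed.

Lemma dirmx_rsum (W : {set {set 'I_d}}) v :
  v *m dirmx R W = 0 <-> forall C, C \in W -> rsum C v = 0.
Proof. exact: dirmxP. Qed.

Lemma affine_hull_rsum (F : set 'rV[R]_d) C r x :
  (forall z, F z -> rsum C z = r) -> affine_hull F x -> rsum C x = r.
Proof.
move=> Fr [n [t [z [Fz t1 ->]]]]; rewrite rsum_sum.
by rewrite (eq_bigr (fun i => t i * r)) => [|i _]; rewrite -?mulr_suml ?t1 ?mul1r // Fr.
Qed.

(** Tight constraints do not change along v. Each loose one allows a step of slack / (1 + |change|),
    where the 1 avoids a zero denominator. *)
Lemma tight_face_perturb y v : cover_polyhedron y ->
  (forall C, C \in rtights y -> rsum C v = 0) ->
  exists2 e, 0 < e & tight_face y (y + e *: v).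
Proof.
move=> [y0 yC] vW.
have [|e1 e10 e1P] := @finite_pos_lower_bound R 'I_d
    (fun i => if y 0 i == 0 then 1 else y 0 i / (1 + `|v 0 i|)).
  move=> i; case: eqP => // /eqP yi; apply: divr_gt0; last by rewrite ltr_pwDl.
  by rewrite lt_neqAle eq_sym yi y0.
have [|e2 e20 e2P] := @finite_pos_lower_bound R {set 'I_d}
    (fun C => if 1 < rsum C y then (rsum C y - 1) / (1 + `|rsum C v|) else 1).
  by move=> C; case: ifP => // C1; rewrite divr_gt0 ?subr_gt0 // ltr_pwDl.
have small (e s a : R) : 0 < e -> e <= a / (1 + `|s|) -> 0 <= a + e * s.
  move=> e0; rewrite ler_pdivlMr ?ltr_pwDl // mulrDr mulr1 => ea.
  have : - (e * s) <= e * `|s|.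
    by rewrite -mulrN ler_pM2l // -normrN ler_norm.
  by lra.
exists (Num.min e1 e2); first by rewrite lt_min e10.
set e := Num.min e1 e2; have e0 : 0 < e by rewrite lt_min e10.
split; last by move=> C CW; rewrite rsumD rsumZ vW // mulr0 addr0.
split=> [i|C CC_].
  rewrite !mxE; case: (eqVneq (y 0 i) 0) => yi.
    have := vW [set i]%SET; rewrite rsum1 => ->; first by rewrite yi mulr0 addr0.
    by apply/rtightsP; right; exists i.
  apply: small => //; have := e1P i; rewrite (negPf yi).
  by apply: le_trans; rewrite ge_min lexx.
rewrite rsumD rsumZ; case: (eqVneq (rsum C y) 1) => C1.
  by rewrite vW ?mulr0 ?addr0 ?C1 //; apply/rtightsP; left.
rewrite -subr_ge0 addrAC; apply: small => //; have := e2P C.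
rewrite lt_neqAle eq_sym C1 yC //=.
by apply: le_trans; rewrite ge_min lexx orbT.
Qed.

Lemma tight_face_dim y : cover_polyhedron y ->
  affine_dim (tight_face y) (dirdim R (rtights y)).
Proof.
move=> yP; have [V [VP dimV _]] := kernel_vspace_dim (dirmx R (rtights y)).
exists y, V; split; last exact: dimV.
apply/seteqP; split=> [x xF|_ [v /VP/dirmx_rsum vW <-]].
  exists (x - y); last by rewrite addrC subrK.
  apply/VP/dirmx_rsum => C CW; rewrite rsumB (@affine_hull_rsum (tight_face y) C (rsum C y)) ?subrr //.
  by move=> z [_ /(_ C CW)].
have [e e0 yeF] := tight_face_perturb yP vW.
(* y + v is the affine combination of y and y + e v with weights 1 - 1/e and 1/e. *)
exists 2%N, (fun i => if i == 0 then 1 - e^-1 else e^-1),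
  (fun i => if i == 0 then y else y + e *: v); split=> [i||].
- by case: ifP.
- by rewrite big_ord_recl big_ord1 /= subrK.
- rewrite big_ord_recl big_ord1 /= scalerDr scalerA mulVf ?gt_eqF // scale1r.
  by rewrite addrA -scalerDl subrK scale1r.
Qed.

(* A point y of F with the fewest tight constraints is in the relative interior of
   F, so its tight constraints hold with equality on all of F; they cover every
   coordinate since the functional defining F has positive coefficients. *)
Lemma compact_face_tights (F : set 'rV[R]_d) j :
  face cover_polyhedron F -> compact F -> affine_dim F j ->
  exists y, [/\ cover_polyhedron y, covers (rtights y) & (j <= dirdim R (rtights y))%N].
Proof.
move=> [[z0 Fz0] [u [c [uP FE]]]] Fcomp [x0 [U [hullF dimU]]].
have FP x : F x -> cover_polyhedron x /\ \sum_i u 0 i * x 0 i = c by rewrite FE.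
have uD x y : \sum_i u 0 i * (x + y) 0 i = \sum_i u 0 i * x 0 i + \sum_i u 0 i * y 0 i.
  by rewrite -big_split; apply: eq_bigr => i _; rewrite mxE mulrDr.
have uZ a x : \sum_i u 0 i * (a *: x) 0 i = a * \sum_i u 0 i * x 0 i.
  by rewrite mulr_sumr; apply: eq_bigr => i _; rewrite mxE mulrCA.
have uU i : \sum_l u 0 l * (delta_mx 0 i : 'rV[R]_d) 0 l = u 0 i.
  rewrite (bigD1 i) //= mxE !eqxx mulr1 big1 ?addr0 // => l /negPf li.
  by rewrite mxE li andbF mulr0.
have rsumU C i : 0 <= rsum C (delta_mx 0 i).
  by apply: sumr_ge0 => l _; rewrite mxE ler0n.
have ray i s x : 0 <= s -> cover_polyhedron x -> cover_polyhedron (x + s *: delta_mx 0 i).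
  move=> s0 [xp xC]; split=> [l|C CC_].
    by rewrite !mxE addr_ge0 // mulr_ge0 // ler0n.
  by rewrite rsumD rsumZ; apply: le_trans (xC C CC_) _; rewrite lerDl mulr_ge0.
(* Adding the i-th unit vector stays in the polyhedron, so u_i >= 0; if u_i = 0, a whole ray lies in
   F, against boundedness. *)
have u_gt0 i : 0 < u 0 i.
  have [z0P z0c] := FP _ Fz0; have := uP _ (ray i 1 z0 ler01 z0P).
  rewrite uD uZ uU z0c mul1r lerDl le_eqVlt => /orP[/eqP ui|//].
  have [M [_ /(_ (M + 1))]] := compact_bounded Fcomp.
  rewrite ltrDl ltr01 => /(_ isT) Mbound.
  pose s := `|M + 1| + `|z0 0 i| + 1.
  have s0 : 0 <= s by rewrite !addr_ge0.
  have : F (z0 + s *: delta_mx 0 i).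
    by rewrite FE; split; [exact: ray|rewrite uD uZ uU -ui mulr0 addr0].
  move/Mbound => /=; rewrite [leLHS]/Num.norm /= mx_normrE => /bigmax_leP[_ /(_ (0, i) isT)] /=.
  rewrite !mxE !eqxx mulr1 /s => H.
  have := ler_norm (z0 0 i + s); have := ler_norm (M + 1); have := ler_norm (- z0 0 i).
  by rewrite normrN /s; move: H; rewrite /s; lra.
pose P n := `[< exists2 y, F y & #|rtights y| = n >].
have exP : exists n, P n by exists #|rtights z0|; apply/asboolP; exists z0.
have [y Fy ymin] : exists2 y, F y & forall z, F z -> (#|rtights y| <= #|rtights z|)%N.
  have [n /asboolP[y Fy <-] nmin] := ex_minnP exP.
  by exists y => // z Fz; apply: nmin; apply/asboolP; exists z.
have [yP yc] := FP _ Fy; have [y0 yC] := yP.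
(* A constraint tight at the midpoint of y and z is tight at y and has equal sums at y and z. As y
   has the fewest tight constraints, the midpoint has the same ones. *)
have tightF z C : F z -> C \in rtights y -> rsum C z = rsum C y.
  move=> Fz CW; have [[zp zC] zc] := FP _ Fz.
  pose w := 2^-1 *: (y + z).
  have wE D : rsum D w = (rsum D y + rsum D z) / 2 by rewrite rsumZ rsumD mulrC.
  have Fw : F w.
    rewrite FE; split; last by rewrite uZ uD yc zc; lra.
    split=> [i|D DC]; last by rewrite wE; have := yC D DC; have := zC D DC; lra.
    by rewrite -rsum1 wE !rsum1; have := y0 i; have := zp i; lra.
  have wsub D : D \in rtights w -> rsum D z = rsum D y /\ D \in rtights y.
    move=> /rtightsP[[DC]|[i -> wi]].
      rewrite wE => D1; have := yC D DC; have := zC D DC => ? ?.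
      by split; [lra|apply/rtightsP; left; split=> //; lra].
    have := y0 i; have := zp i; move: wi; rewrite -rsum1 wE !rsum1 => ? ? ?.
    by split; [lra|apply/rtightsP; right; exists i => //; lra].
  have ww : rtights w = rtights y.
    apply/eqP; rewrite eqEcard ymin // andbT.
    by apply/fintype.subsetP => D /wsub[].
  by have [|-> _] := wsub C; rewrite ?ww.
exists y; split=> // [i|].
  case: (eqVneq (y 0 i) 0) => [yi|yi].
    by exists [set i]%SET; rewrite ?set11 //; apply/rtightsP; right; exists i.
  (* Otherwise coordinate i can be lowered slightly inside the polyhedron, which pushes the
     functional below its minimum c. *)
  apply: contrapT => noC.
  have [|e e0 eP] := @finite_pos_lower_bound R {set 'I_d}
      (fun C => if (C \in CC) && (i \in C) then rsum C y - 1 else y 0 i).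
    move=> C; case: ifP => [/andP[CC_ iC]|_]; last by rewrite lt_neqAle eq_sym yi y0.
    rewrite subr_gt0 lt_neqAle yC // andbT eq_sym; apply/eqP => C1.
    by apply: noC; exists C => //; apply/rtightsP; left.
  pose f := Num.min e (y 0 i).
  have f0 : 0 < f by rewrite lt_min e0 lt_neqAle eq_sym yi y0.
  suff /uP : cover_polyhedron (y + (- f) *: delta_mx 0 i).
    by rewrite uD uZ uU yc; have := mulr_gt0 f0 (u_gt0 i); lra.
  have fy : f <= y 0 i by rewrite ge_min lexx orbT.
  have fe : f <= e by rewrite ge_min lexx.
  split=> [l|C CC_].
    rewrite !mxE eqxx /=; case: eqP => [->|_]; last by rewrite mulr0 addr0.
    by rewrite mulr1 subr_ge0.
  rewrite rsumD rsumZ; case: (boolP (i \in C)) => iC.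
    have -> : rsum C (delta_mx 0 i) = 1.
      rewrite /rsum (bigD1 i) //= mxE !eqxx big1 ?addr0 // => l /andP[_ /negPf li].
      by rewrite mxE li andbF.
    by have := eP C; rewrite CC_ iC /=; lra.
  have -> : rsum C (delta_mx 0 i) = 0.
    rewrite /rsum big1 // => l lC; rewrite mxE eqxx /=; case: eqP => // li.
    by rewrite -li lC in iC.
  by rewrite mulr0 addr0 yC.
have [V [VP _ Vmax]] := kernel_vspace_dim (dirmx R (rtights y)).
rewrite -dimU; apply: Vmax; apply/subvP => v Uv; apply/VP/dirmx_rsum => C CW.
have hull w : w \in U -> rsum C (x0 + w) = rsum C y.
  move=> Uw; apply: (@affine_hull_rsum F) => [z Fz|]; first exact: tightF.
  by rewrite hullF; exists w.
have := hull v Uv; have := hull 0 (mem0v U); rewrite addr0 rsumD => -> /eqP.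
by rewrite -subr_eq0 addrAC subrr add0r => /eqP.
Qed.

End SymbolicPolyhedronFaces.

(** * Covering points, and the two computations of the symbolic analytic spread *)

Section CoveringPoints.
Variables (d : nat) (CC : {set {set 'I_d}}).

(** The all-ones vector satisfies the constraints because no C is empty; a solution of least total
    degree cannot be lowered, so it is covering. *)
Lemma covering_point_ex : (forall C, C \in CC -> C != finset.set0) ->
  exists m, deg_ge CC 1 m /\ covers (tights CC 1 m).
Proof.
move=> CC0; pose P n := `[< exists2 m, deg_ge CC 1 m & mdeg m = n >].
have exP : exists n, P n.
  exists (mdeg [multinom 1%N | _ < d]); apply/asboolP.
  exists [multinom 1%N | _ < d] => // C /CC0/set0Pn[i iC].
  by apply: leq_trans (csum_ge _ iC); rewrite mnmE.
have [n /asboolP[m md mn] nmin] := ex_minnP exP.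
exists m; split=> //; apply/(covers_minimal md) => i mi md'.
have : P (mdeg (m - U_(i))%MM) by apply/asboolP; exists (m - U_(i))%MM.
move=> /nmin; rewrite -mn -[leqLHS](congr1 (@mdeg d) (submK (_ : (U_(i) <= m)%MM))).
  by rewrite mdegD mdeg1 addn1 ltnn.
by rewrite lep1mP -lt0n.
Qed.

(** In degree 0 a covering m is 0, so every singleton is tight and no direction remains. *)
Lemma dirdim_tights0 m : covers (tights CC 0 m) -> dirdim rat (tights CC 0 m) = 0%N.
Proof.
move=> cov; have [V [VP dimV _]] := kernel_vspace_dim (dirmx rat (tights CC 0 m)).
rewrite /dirdim -dimV; apply/eqP; rewrite dimv_eq0 -subv0; apply/subvP => v /VP/dirmxP vW.
rewrite memv0; apply/eqP/rowP => i; rewrite mxE.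
have := vW [set i]%SET; rewrite big_set1; apply; apply/tightsP; right; exists i => //.
by apply/eqP; rewrite -leqn0; exact: tights_le cov.
Qed.

End CoveringPoints.

Lemma symbolic_polyhedronE (R : realType) (K : fieldType) d (I : ideal {mpoly K[d]}) :
  symbolic_polyhedron R I = @cover_polyhedron R d (min_covers I).
Proof.
have rsumE (p : ideal {mpoly K[d]}) (a : 'rV[R]_d) :
    \sum_(i < d | `[< p 'X_i >]) a 0 i = rsum (var_set p) a.
  by apply: eq_bigl => i; rewrite in_var_set.
apply/seteqP; split=> a [a0 aI]; split=> //.
  by move=> C /min_coversP[p pI ->]; rewrite -rsumE; exact: aI.
by move=> p pI; rewrite rsumE; apply: aI; apply/min_coversP; exists p.
Qed.

Theorem mainTheorem9 (K : fieldType) (R : realType) (d : nat)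
    (I : ideal {mpoly K[d]})
    (I_sqf : squarefree_monomial I)
    (I_nonzero : exists f, I f /\ f <> 0%R)
    (I_proper : ~ I 1%R) :
  exists l : nat,
    [/\ symbolic_analytic_spread I l,
        exists g : nat, (0 < g)%N /\ analytic_spread (symb_pow I g) l &
        exists k : nat,
          max_compact_face_dim (symbolic_polyhedron R I) k /\ l = (1 + k)%N].
Proof.
set CC := min_covers I.
(* The maximal such k will be the largest dimension of a compact face; it is found here among the
   rational points m/n. *)
pose P k := `[< exists n m, [/\ (0 < n)%N, deg_ge CC n m, covers (tights CC n m) &
  dirdim rat (tights CC n m) = k] >].
have exP : exists k, P k.
  have [C|m [md mcov]] := @covering_point_ex d CC; first exact: min_covers_gt0.
  by exists (dirdim rat (tights CC 1 m)); apply/asboolP; exists 1%N, m.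
have Pd k : P k -> (k <= d)%N.
  by move=> /asboolP[n [m [_ _ _ <-]]]; exact: dirdim_le.
have [k Pk kmax] := ex_maxnP exP Pd.
have [n0 [m0 [n0_gt0 m0d m0cov m0k]]] := asboolP _ Pk.
have dir_le n m : deg_ge CC n m -> covers (tights CC n m) ->
    (dirdim rat (tights CC n m) <= k)%N.
  move=> md mcov; have [n0'|n_gt0] := posnP n.
    by rewrite n0' in mcov *; rewrite dirdim_tights0.
  by apply: kmax; apply/asboolP; exists n, m.
(* The dimension does not depend on g, so the same k serves the symbolic filtration (g = 1) and the
   powers of I^(g). *)
have krull (F : filtration {mpoly K[d]}) g : (0 < g)%N ->
    (forall n f, F n f <-> forall m, m \in msupp f -> deg_ge CC (g * n) m) ->
    krull_dim (fiber_ring F) k.+1.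
  move=> g0 FE; split; last by move=> m Q; exact: (fiber_krull_upper FE (Pd k Pk) dir_le).
  by rewrite -m0k; exact: (fiber_krull_lower FE g0 n0_gt0 m0d m0cov).
exists (1 + k)%N; split.
- apply: (krull _ 1%N) => // n f; rewrite mul1n; split=> [/(symb_powP I_sqf) If m mf C CI|fd].
    exact: If mf.
  by apply/(symb_powP I_sqf) => C CI m mf; exact: fd.
- have [g g0 gE] := symb_pow_veronese I_sqf.
  by exists g; split=> //; exact: (krull (pow_filtration (symb_pow I g)) g g0 gE).
exists k; split=> //; rewrite symbolic_polyhedronE -/CC; split.
  pose y := n0%:R^-1 *: mrow R m0.
  have yP : cover_polyhedron CC y by exact: cover_polyhedron_ofnat.
  have yW : rtights CC y = tights CC n0 m0 by rewrite (tights_ofnat R).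
  exists (tight_face CC y); split; first exact: tight_face_face.
    by apply: tight_face_compact => //; rewrite yW.
  by rewrite -m0k -(dirdim_map (ratr : {rmorphism rat -> R})) -yW; exact: tight_face_dim.
move=> F j Fface Fcomp Fdim.
have [y [yP ycov jy]] := compact_face_tights Fface Fcomp Fdim.
(* The tight set of the real point y is also that of some m/n, where k bounds the dimension. *)
have [n [m [n_gt0 nm mW]]] := cover_polyhedron_rational yP.
apply: leq_trans jy _; rewrite (dirdim_map (ratr : {rmorphism rat -> R})) -mW.
by apply: dir_le; rewrite ?mW.
Qed.
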